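(* Let $n\ge 1$, $R>0$, $p>1$, and let $B_R\subset\mathbb{R}^n$ be the ball of radius $R$ centered at the origin, with outward unit normal $\eta$ on $\partial B_R$. Let $u_0:\overline{B}_R\to\mathbb{R}$ be smooth, not identically zero, nonnegative, radially symmetric, and such that $$\frac{\partial u_0}{\partial\eta}=e^{u_0^p}\ \text{ on } \partial B_R,\qquad \Delta u_0\ge a\ \text{ in } \overline{B}_R$$ for some constant $a>0$. Let $u$ be a classical solution of $$u_t=\Delta u\ \text{ in } B_R\times(0,T),\qquad \frac{\partial u}{\partial\eta}=e^{u^p}\ \text{ on } \partial B_R\times(0,T),\qquad u(x,0)=u_0(x)\ \text{ for } x\in B_R,$$ which blows up in finite time, with blow-up time $T$. Then there exists a constant $C>0$ such that $$\max_{x\in\overline{B}_R}u(x,t)\le \log C-\frac{1}{2p}\log(T-t),\qquad 0<t<T.$$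
   Context: A (nonnegative) classical solution is one that is continuous on $\overline{B}_R\times[0,T)$, is $C^{2}$ in $x$ (with first-order spatial derivatives continuous up to $\partial B_R$) and $C^1$ in $t$ for $0<t<T$, and satisfies the problem pointwise; the classical solution of this problem is unique. The solution blows up with blow-up time $T$ if it is a classical solution on $[0,T)$, $0<T<\infty$, and $\max_{\overline{B}_R}u(\cdot,t)\to\infty$ as $t\to T^-$. *)

(* Defs.v *)
From HB Require Import structures.
From mathcomp Require Import all_boot all_order all_algebra.
From mathcomp Require Import all_classical all_reals all_analysis.
Set Implicit Arguments.
Unset Strict Implicit.
Unset Printing Implicit Defensive.
Import Order.TTheory GRing.Theory Num.Theory numFieldNormedType.Exports.
Local Open Scope classical_set_scope.
Local Open Scope ring_scope.

(* The library norm on 'rV[R]_n is the sup norm; balls below are Euclidean. *)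
Definition enorm (R : realType) (n : nat) (x : 'rV[R]_n) : R :=
  Num.sqrt (\sum_(i < n) x ord0 i ^+ 2).

Definition oball (R : realType) (n : nat) (r : R) : set 'rV[R]_n :=
  [set x | enorm x < r].

Definition cball (R : realType) (n : nat) (r : R) : set 'rV[R]_n :=
  [set x | enorm x <= r].

Definition esphere (R : realType) (n : nat) (r : R) : set 'rV[R]_n :=
  [set x | enorm x = r].

Definition max_cball (R : realType) (n : nat) (r : R) (f : 'rV[R]_n -> R) : R :=
  sup (f @` cball r).

Definition partial (R : realType) (n : nat) (i : 'I_n) (f : 'rV[R]_n -> R) :
    'rV[R]_n -> R :=
  fun x => 'D_(delta_mx ord0 i) f x.

Definition laplacian (R : realType) (n : nat) (f : 'rV[R]_n -> R) :
    'rV[R]_n -> R :=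
  fun x => \sum_(i < n) partial i (partial i f) x.

(* Functions on the closed ball are represented by total functions whose values
   outside it are irrelevant.  Accordingly, two-sided derivatives are only taken
   at points of the open ball, and a derivative at a boundary point means the
   limit of its values from inside. *)

(* [f], considered on [A] only, extends continuously to [B], where [A] is dense
   in [B].  At a point of [A] the limit is necessarily the value of [f], so this
   includes the continuity of [f] on [A]. *)
Definition extends_continuously (X : topologicalType) (R : realType)
    (A B : set X) (f : X -> R) : Prop :=
  forall z, B z -> cvg (f y @[y --> within A (nbhs z)]).

Definition cball_ext (R : realType) (n : nat) (r : R) (f : 'rV[R]_n -> R) :
    'rV[R]_n -> R :=
  fun x => lim (f y @[y --> within (oball r) (nbhs x)]).

(* Gradient dotted with the outward unit normal x / r. *)
Definition normal_derivative (R : realType) (n : nat) (r : R)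
    (f : 'rV[R]_n -> R) (x : 'rV[R]_n) : R :=
  \sum_(i < n) cball_ext r (partial i f) x * (x ord0 i / r).

Definition iter_partial (R : realType) (n : nat) (s : seq 'I_n)
    (f : 'rV[R]_n -> R) : 'rV[R]_n -> R :=
  foldr (@partial R n) f s.

(* C^oo on the closed ball. *)
Definition smooth_on_cball (R : realType) (n : nat) (r : R)
    (f : 'rV[R]_n -> R) : Prop :=
  [/\ {within cball r, continuous f},
      (forall (s : seq 'I_n) (i : 'I_n) x, oball r x ->
         derivable (iter_partial s f) x (delta_mx ord0 i)) &
      (forall s : seq 'I_n,
         extends_continuously (oball r) (cball r) (iter_partial s f))].

Definition radial_on_cball (R : realType) (n : nat) (r : R)
    (f : 'rV[R]_n -> R) : Prop :=
  forall x y, cball r x -> cball r y -> enorm x = enorm y -> f x = f y.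

(* Nonnegative classical solution on [0, T); the derivatives are continuous
   jointly in (x, t), i.e. [u] is C^{2,1} inside, and C^1 in x up to the
   boundary, for 0 < t < T. *)
Record classical_solution (R : realType) (n : nat) (r p T : R)
    (u0 : 'rV[R]_n -> R) (u : 'rV[R]_n -> R -> R) : Prop := {
  sol_ge0 : forall x (t : R), cball r x -> 0 <= t < T -> 0 <= u x t ;
  sol_continuous :
    {within cball r `*` `[0, T[, continuous (fun z : 'rV[R]_n * R => u z.1 z.2)} ;
  sol_derivable_x : forall (i : 'I_n) x (t : R), oball r x -> 0 < t < T ->
    derivable (u ^~ t) x (delta_mx ord0 i) ;
  sol_continuous_x : forall i : 'I_n,
    extends_continuously (oball r `*` `]0, T[) (cball r `*` `]0, T[)
      (fun z : 'rV[R]_n * R => partial i (u ^~ z.2) z.1) ;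
  sol_derivable_xx : forall (i j : 'I_n) x (t : R), oball r x -> 0 < t < T ->
    derivable (partial i (u ^~ t)) x (delta_mx ord0 j) ;
  sol_continuous_xx : forall i j : 'I_n,
    {within oball r `*` `]0, T[, continuous
      (fun z : 'rV[R]_n * R => partial j (partial i (u ^~ z.2)) z.1)} ;
  sol_derivable_t : forall x (t : R), oball r x -> 0 < t < T -> derivable (u x) t 1 ;
  sol_continuous_t :
    {within oball r `*` `]0, T[, continuous
      (fun z : 'rV[R]_n * R => derive1 (u z.1) z.2)} ;
  sol_heat : forall x (t : R), oball r x -> 0 < t < T ->
    derive1 (u x) t = laplacian (u ^~ t) x ;
  sol_flux : forall x (t : R), esphere r x -> 0 < t < T ->
    normal_derivative r (u ^~ t) x = expR (u x t `^ p) ;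
  sol_initial : forall x, oball r x -> u x 0 = u0 x
}.

Definition blows_up_at (R : realType) (n : nat) (r p T : R)
    (u0 : 'rV[R]_n -> R) (u : 'rV[R]_n -> R -> R) : Prop :=
  [/\ 0 < T, classical_solution r p T u0 u &
      max_cball r (u ^~ t) @[t --> T^'-] --> +oo].

(* Main.v *)
Require Import Defs.
From HB Require Import structures.
From mathcomp Require Import all_boot all_order all_algebra.
From mathcomp Require Import all_classical all_reals all_analysis.
From mathcomp Require Import ring lra.
Set Implicit Arguments.
Unset Strict Implicit.
Unset Printing Implicit Defensive.
Import Order.TTheory GRing.Theory Num.Theory numFieldNormedType.Exports.
Local Open Scope classical_set_scope.
Local Open Scope ring_scope.

(** The theorem follows from one pointwise inequality, obtained with the minimum
principle alone: for some [e > 0] and all [x] in the closed ball,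
   e h <= exp (- 2 p u(x, t)) - exp (- 2 p u(x, t + h))   whenever t + h < T
([solution_exp_decrease]).  Dropping the last exponential, which is positive,
and letting [h] tend to [T - t] gives e (T - t) <= exp (- 2 p u(x, t)), which is
the claimed bound after taking logarithms.

Why the inequality holds, formally: the time derivative v of u solves the heat
equation with boundary condition dv/dn = f'(u) v, where f(u) = exp (u^p), while
g(u) = exp (2 p u) satisfies g(u)_t <= Laplacian g(u) because g is convex, and
dg(u)/dn = g'(u) f(u) <= f'(u) g(u) as soon as 2 p <= p u^(p-1), that is, where u
exceeds S = 2^(1/(p-1)).  Where u <= S the function g(u) is bounded, and there
v >= a, since Laplacian u0 >= a at time 0.  So v >= e' g(u) for a small e', and
integrating in time gives the inequality.

Only first-order spatial regularity is available up to the boundary, so v cannot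
be compared there.  The argument is therefore run on the pair u(., t), u(., t+h):
- [comparison], a comparison principle with a Lipschitz flux, first gives
  u(x, t) >= u0(x) + a t, then u(x, t + h) >= u(x, t) + a h;
- [exp_comparison] treats W = exp (- k u(., t)) - exp (- k u(., t + h)), k = 2 p.
  At an interior critical point of W the gradient terms have the good sign
  because u(., t) < u(., t + h).  At a boundary minimum where u > S the outward
  derivative of W is positive, which is impossible, since exp (s^p - k s)
  is strictly increasing for s >= S ([powR_sub_linear_lt]).

At a minimum on the cylinder, the second derivatives along coordinate lines, the
time derivative, and the slope along the inward ray have known signs.  All three
are statements about functions of one real variable, to which the calculus is
reduced: [coord_jet2] for coordinate lines, [inward_slope] for rays.  The link
between the inward slope and the normal derivative is the chain rule for
functions with continuous partial derivatives ([is_derive_of_partials]). *)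

(** * One-variable calculus *)

Lemma is_derive_continuous (R : realType) (F : R -> R) (x l : R) :
  is_derive x 1 F l -> F y @[y --> x] --> F x.
Proof.
move=> dF; have /derivable1_diffP := @ex_derive _ _ _ _ _ _ _ dF.
exact: differentiable_continuous.
Qed.

(** By the mean value theorem a negative derivative to the right of 0 would make
[F] drop below [F 0].  Only points to the right of 0 enter, so this applies to
rays going into a domain from its boundary. *)
Lemma right_min_deriv_not_neg (R : realType) (F F1 : R -> R) :
  F s @[s --> (0:R)^'+] --> F 0 ->
  (\forall s \near (0:R)^'+, is_derive (s:R) 1 F (F1 s)) ->
  (\forall s \near (0:R)^'+, F 0 <= F s) ->
  ~ (\forall s \near (0:R)^'+, F1 s < 0).
Proof.
move=> F0 dF Fmin F1neg.
have [e /= e0 He] : \forall s \near (0:R)^'+, is_derive (s:R) 1 F (F1 s) /\ F1 s < 0.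
  exact: filterI.
have /filter_ex[b [b0 Fb be]] : \forall b \near (0:R)^'+,
    [/\ 0 < b, F 0 <= F b & b < e].
  near=> b; split; near: b => //; [exact: nbhs_right_gt|exact: nbhs_right_lt].
have Hb s : 0 < s -> s <= b -> is_derive (s:R) 1 F (F1 s) /\ F1 s < 0.
  move=> s0 sb; apply: He => //=.
  by rewrite sub0r normrN gtr0_norm// (le_lt_trans sb).
have cF : {within `[0, b], continuous F}.
  apply/continuous_within_itvP => //; split => //.
    move=> x /[!in_itv]/= /andP[x0 xb].
    have [dx _] := Hb x x0 (ltW xb).
    exact: is_derive_continuous dx.
  have [dx _] := Hb b b0 (lexx b).
  apply: cvg_at_left_filter.
  exact: is_derive_continuous dx.
have dF' (s : R) : s \in `]0, b[ -> is_derive s 1 F (F1 s).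
  by rewrite in_itv/= => /andP[s0 sb]; have [] := Hb s s0 (ltW sb).
have [c /[!in_itv]/= /andP[c0 cb]] := MVT b0 dF' cF.
have [_ c1] := Hb c c0 (ltW cb).
move: Fb => /[swap] E; rewrite -subr_ge0 E subr0 leNgt => /negP; apply.
by rewrite pmulr_llt0.
Unshelve. all: by end_near. Qed.

Lemma right_min_deriv_lim_ge0 (R : realType) (F F1 : R -> R) (l : R) :
  F s @[s --> (0:R)^'+] --> F 0 ->
  (\forall s \near (0:R)^'+, is_derive (s:R) 1 F (F1 s)) ->
  F1 s @[s --> (0:R)^'+] --> l ->
  (\forall s \near (0:R)^'+, F 0 <= F s) -> 0 <= l.
Proof.
move=> F0 dF F1l Fmin; rewrite leNgt; apply/negP => l0.
apply: (right_min_deriv_not_neg F0 dF Fmin).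
exact: (cvgr_lt l F1l).
Qed.

(** If [q < 0] then [g1 < 0] just to the right of 0, because [g1 0 = 0]; this
contradicts the one-sided lemma above. *)
Lemma min_second_derivative (R : realType) (g g1 : R -> R) (q : R) :
  (\forall s \near (0:R), is_derive (s:R) 1 g (g1 s)) -> is_derive (0:R) 1 g1 q ->
  (\forall s \near (0:R), g 0 <= g s) -> g1 0 = 0 /\ 0 <= q.
Proof.
move=> dg dg1 gmin.
have g10 : g1 0 = 0.
  have [e /= e0 He] : \forall s \near (0:R), is_derive (s:R) 1 g (g1 s) /\ g 0 <= g s.
    by apply: filterI.
  have Hin t : t \in `]-e, e[ -> ball (0:R) e t.
    by rewrite in_itv/= /ball/= sub0r normrN ltr_norml.
  have d0 : is_derive (0:R) 1 g 0.
    apply: (@derive1_at_min R g (- e) e 0).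
    - by rewrite ge0_cp// ltW.
    - by move=> t /Hin/He[d _]; exact: (@ex_derive _ _ _ _ _ _ _ d).
    - by rewrite in_itv/= oppr_lt0 e0.
    - by move=> t /Hin/He[].
  have d1 := nbhs_singleton dg.
  by rewrite -(@derive_val _ _ _ _ _ _ _ d1) (@derive_val _ _ _ _ _ _ _ d0).
split=> //; rewrite leNgt; apply/negP => q0.
apply: (@right_min_deriv_not_neg R g g1).
- apply: cvg_at_right_filter.
  have d1 := nbhs_singleton dg.
  exact: is_derive_continuous d1.
- exact: cvg_at_right_filter dg.
- exact: cvg_at_right_filter gmin.
have : (fun h : R => h^-1 *: ((g1 \o shift 0) (h *: 1) - g1 0)) @ 0^' --> q.
  by have := @ex_derive _ _ _ _ _ _ _ dg1; rewrite /derivable => /cvg_ex[l hl];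
  rewrite -(@derive_val _ _ _ _ _ _ _ dg1) /derive (cvg_lim _ hl).
move=> /(cvgr_lt q) /(_ _ q0) => -[e /= e0 He].
exists e => //= s se s0.
have := He s se; rewrite /= g10 subr0 addr0 [_%:A]mulr1 gt_eqF// => /(_ isT).
by rewrite pmulr_rlt0// invr_gt0.
Qed.

(** Only past values are compared, so that [t] may be the final time. *)
Lemma left_min_deriv_le0 (R : realType) (F : R -> R) (t l : R) :
  0 < t -> is_derive t 1 F l ->
  (forall s, 0 <= s -> s <= t -> F t <= F s) -> l <= 0.
Proof.
move=> t0 dF Fmin; rewrite leNgt; apply/negP => l0.
have : (fun h : R => h^-1 *: ((F \o shift t) (h *: 1) - F t)) @ 0^' --> l.
  by have := @ex_derive _ _ _ _ _ _ _ dF; rewrite /derivable => /cvg_ex[m hm];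
  rewrite -(@derive_val _ _ _ _ _ _ _ dF) /derive (cvg_lim _ hm).
move=> /(cvgr_gt l) /(_ _ l0) => -[e /= e0 He].
pose h := - (Num.min (e / 2) t).
have m0 : 0 < Num.min (e / 2) t by rewrite lt_min t0 andbT divr_gt0.
have h0 : h < 0 by rewrite oppr_lt0.
have := He h; rewrite /= sub0r opprK gtr0_norm// lt_eqF//.
have -> : Num.min (e / 2) t < e.
  by rewrite gt_min ltr_pdivrMr// ltr_pMr// ltr1n.
move=> /(_ isT isT); rewrite [_%:A]mulr1.
rewrite nmulr_rgt0 ?invr_lt0// subr_lt0 ltNge Fmin//.
  by rewrite /h addrC subr_ge0 ge_min lexx orbT.
by rewrite gerDr ltW.
Qed.

(** * Euclidean balls *)

Lemma cvg_sumr (R : realType) (T : Type) (F : set_system T) (FF : Filter F)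
    (n : nat) (f : 'I_n -> T -> R) (a : 'I_n -> R) :
  (forall i, f i x @[x --> F] --> a i) ->
  \sum_(i < n) f i x @[x --> F] --> \sum_(i < n) a i.
Proof. by move=> fa; apply: cvg_big => //; exact: add_continuous. Qed.

Lemma enorm_ge0 (R : realType) (n : nat) (x : 'rV[R]_n) : 0 <= enorm x.
Proof. exact: sqrtr_ge0. Qed.

Lemma sqr_enorm (R : realType) (n : nat) (x : 'rV[R]_n) :
  enorm x ^+ 2 = \sum_(i < n) x ord0 i ^+ 2.
Proof. by rewrite sqr_sqrtr// sumr_ge0// => i _; exact: sqr_ge0. Qed.

Lemma enormZ (R : realType) (n : nat) (c : R) (x : 'rV[R]_n) :
  enorm (c *: x) = `|c| * enorm x.
Proof.
apply/eqP; rewrite -(@eqrXn2 _ 2)// ?mulr_ge0 ?enorm_ge0//.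
rewrite exprMn !sqr_enorm real_normK ?num_real// mulr_sumr.
by apply/eqP/eq_bigr => i _; rewrite mxE exprMn.
Qed.

Lemma enorm0 (R : realType) (n : nat) : enorm (0 : 'rV[R]_n) = 0.
Proof. by rewrite -(scale0r 0) enormZ normr0 mul0r. Qed.

Lemma coord_le_enorm (R : realType) (n : nat) (x : 'rV[R]_n) (i : 'I_n) :
  `|x ord0 i| <= enorm x.
Proof.
rewrite -ler_sqr ?nnegrE ?enorm_ge0// sqr_enorm real_normK ?num_real//.
by rewrite (bigD1 i)//= lerDl sumr_ge0// => j _; exact: sqr_ge0.
Qed.

Lemma sqr_enorm_coord (R : realType) (n : nat) (x : 'rV[R]_n) (i : 'I_n) (s : R) :
  enorm (s *: delta_mx ord0 i + x) ^+ 2 =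
  enorm x ^+ 2 + 2 * s * x ord0 i + s ^+ 2.
Proof.
rewrite !sqr_enorm (bigD1 i)//= [in RHS](bigD1 i)//=.
rewrite !mxE !eqxx/= mulr1.
rewrite (eq_bigr (fun j => x ord0 j ^+ 2)).
  by rewrite sqrrD -mulr_natl; ring.
by move=> j ji; rewrite !mxE eqxx/= (negbTE ji) mulr0 add0r.
Qed.

Lemma enorm_continuous (R : realType) (n : nat) :
  continuous (@enorm R n : 'rV[R]_n -> R).
Proof.
move=> x; apply: (@continuous_comp _ _ _ (fun y : 'rV[R]_n =>
  \sum_(i < n) y ord0 i ^+ 2) Num.sqrt); last exact: sqrt_continuous.
apply: (cvg_sumr (nbhs_filter x)) => i; apply: (@continuous_comp _ _ _
   (fun y : 'rV[R]_n => y ord0 i) (fun s : R => s ^+ 2)).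
  exact: coord_continuous.
exact: exprn_continuous.
Qed.

Lemma open_oball (R : realType) (n : nat) (r : R) : open (@oball R n r).
Proof.
rewrite (_ : oball r = @enorm R n @^-1` [set s | s < r])//.
by apply: open_comp; [move=> x _; exact: enorm_continuous|exact: open_lt].
Qed.

Lemma compact_cball (R : realType) (n : nat) (r : R) : compact (@cball R n r).
Proof.
apply: bounded_closed_compact.
  exists r; split; first exact: num_real.
  move=> M rM x xr /=; rewrite [leLHS]/Num.Def.normr/= mx_normrE.
  apply: bigmax_le => /=; first by rewrite (le_trans (enorm_ge0 x))// (le_trans xr)// ltW.
  move=> [i j] _ /=; rewrite ord1 (le_trans (coord_le_enorm _ _))//.
  by rewrite (le_trans xr)// ltW.
rewrite (_ : cball r = @enorm R n @^-1` [set s | s <= r])//.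
by apply: closed_comp; [move=> x _; exact: enorm_continuous|exact: closed_le].
Qed.

Lemma oball_near (R : realType) (n : nat) (r : R) (x : 'rV[R]_n) :
  oball r x -> \forall y \near x, oball r y.
Proof. by move=> xr; exact: open_nbhs_nbhs (conj (@open_oball R n r) xr). Qed.

(** * Derivatives along lines from partial derivatives *)

Lemma line_continuous (R : realType) (n : nat) (v x : 'rV[R]_n) :
  continuous (fun s : R => s *: v + x).
Proof.
move=> s; apply: cvgD; last exact: cvg_cst.
by apply: cvgZr_tmp; exact: cvg_id.
Qed.

Lemma MVT_from0 (R : realType) (g g1 : R -> R) (c : R) :
  (forall s : R, `|s| <= `|c| -> is_derive s 1 g (g1 s)) ->
  exists2 xi, `|xi| <= `|c| & g c - g 0 = g1 xi * c.
Proof.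
move=> dg.
have cg a b : (forall s, s \in `[a, b] -> `|s| <= `|c|) ->
    {within `[a, b], continuous g}.
  move=> H; apply: derivable_within_continuous => s /H sc.
  exact: (@ex_derive _ _ _ _ _ _ _ (dg s sc)).
have [c0|c0|c0] := ltgtP c 0.
- have H s : s \in `[c, 0] -> `|s| <= `|c|.
    rewrite in_itv/= => /andP[cs s0]; rewrite !ler0_norm// ?lerN2//.
    exact: ltW.
  have dg' (s : R) : s \in `]c, 0[ -> is_derive s 1 g (g1 s).
    by move=> /subset_itv_oo_cc /H /dg.
  have [xi xiin E] := MVT c0 dg' (cg _ _ H).
  exists xi; first by apply: H; exact: subset_itv_oo_cc.
  by rewrite -opprB E; ring.
- have H s : s \in `[0, c] -> `|s| <= `|c|.
    rewrite in_itv/= => /andP[s0 sc]; rewrite !ger0_norm//.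
    exact: ltW.
  have dg' (s : R) : s \in `]0, c[ -> is_derive s 1 g (g1 s).
    by move=> /subset_itv_oo_cc /H /dg.
  have [xi xiin E] := MVT c0 dg' (cg _ _ H).
  exists xi; first by apply: H; exact: subset_itv_oo_cc.
  by rewrite E subr0.
- by exists 0; rewrite c0 ?subrr ?mulr0.
Qed.

Lemma is_derive_line (R : realType) (n : nat) (v : 'rV[R]_n -> R)
    (w x : 'rV[R]_n) (s l : R) :
  is_derive (s *: w + x) w v l -> is_derive s 1 (fun t => v (t *: w + x)) l.
Proof.
move=> [dv ev].
have E : (fun h : R => h^-1 *: (v (h *: w + (s *: w + x)) - v (s *: w + x))) =
   (fun h : R => h^-1 *: (v ((h *: (1:R) + s) *: w + x) - v (s *: w + x))).
  by apply/funext => h; rewrite [h%:A]mulr1 scalerDl addrA.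
apply: DeriveDef; first by rewrite /derivable/= -E.
by rewrite /derive/= -E.
Qed.

(** The increment [v (h *: w + x) - v x] is split into steps parallel to the axes;
the mean value theorem on each step evaluates a partial derivative at a point
close to [x]. *)
Lemma is_derive_of_partials (R : realType) (n : nat) (v : 'rV[R]_n -> R)
    (w x : 'rV[R]_n) :
  (forall i, \forall y \near x, derivable v y (delta_mx ord0 i)) ->
  (forall i, partial i v y @[y --> x] --> partial i v x) ->
  is_derive x w v (\sum_(i < n) w ord0 i * partial i v x).
Proof.
move=> dv cv.
set l := \sum_(i < n) _.
suff dl : h^-1 *: (v (h *: w + x) - v x) @[h --> (0:R)^'] --> l.
  by apply: DeriveDef; [apply/cvg_ex; exists l|exact: cvg_lim dl].
pose M := 1 + \sum_(i < n) `|w ord0 i|.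
have M0 : 0 < M by rewrite ltr_pwDl// sumr_ge0.
have wM i : `|w ord0 i| <= M.
  by rewrite /M (bigD1 i)//= addrCA lerDl addr_ge0// sumr_ge0.
apply/cvgrPdist_le => e e0.
have /nbhs_ballP[d /= d0 Hd] : \forall y \near x, forall i,
    derivable v y (delta_mx ord0 i) /\ `|partial i v x - partial i v y| <= e / M.
  apply: (@filter_forall _ _ _ _ (nbhs_filter x)) => i.
  apply: (@filterI _ _ (nbhs_filter x)); first exact: dv.
  by have /cvgrPdist_le/(_ (e / M)) := cv i; apply; rewrite divr_gt0.
(* [z h k] is [x] moved by the first [k] coordinates of [h *: w]. *)
pose z (h : R) (k : nat) : 'rV[R]_n :=
  \row_j (if (j < k)%N then h * w ord0 j else 0) + x.
near=> h.
have h0 : h != 0 by near: h; exact: nbhs_dnbhs_neq.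
have hd : `|h| * M < d.
  rewrite -ltr_pdivlMr//; near: h; apply: dnbhs0_lt; exact: divr_gt0.
have hw i : `|h * w ord0 i| < d.
  by rewrite normrM (le_lt_trans _ hd)// ler_wpM2l.
have step (k : 'I_n) :
    `|v (z h k.+1) - v (z h k) - h * w ord0 k * partial k v x| <=
      `|h| * (`|w ord0 k| * (e / M)).
  have zk : z h k.+1 = (h * w ord0 k) *: delta_mx ord0 k + z h k.
    apply/rowP => j; rewrite !mxE eqxx/= ltnS.
    have [->|jk] := eqVneq j k; first by rewrite leqnn ltnn mulr1 add0r.
    by rewrite leq_eqVlt (negbTE (_ : val j != val k)) ?mulr0 ?add0r.
  have zin (s : R) : `|s| <= `|h * w ord0 k| ->
      ball x d (s *: delta_mx ord0 k + z h k).
    move=> sh; split => // i j; rewrite ord1 /ball/= !mxE eqxx/=.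
    have [->|jk] := eqVneq j k.
      by rewrite ltnn mulr1 add0r opprD addrC subrK normrN (le_lt_trans sh).
    rewrite mulr0 add0r; case: ifP => _; last by rewrite add0r subrr normr0.
    by rewrite opprD addrC subrK normrN.
  have [|xi xih] := @MVT_from0 R (fun s => v (s *: delta_mx ord0 k + z h k))
     (fun s => partial k v (s *: delta_mx ord0 k + z h k)) (h * w ord0 k).
    move=> s sh; apply: is_derive_line; apply: derivableP.
    exact: (Hd _ (zin s sh) k).1.
  rewrite -zk scale0r add0r => ->.
  have [_ H] := Hd _ (zin xi xih) k.
  rewrite [_ * (h * _)]mulrC -mulrBr normrM normrM -mulrA.
  by rewrite !ler_wpM2l// distrC.
have -> : v (h *: w + x) - v x = \sum_(k < n) (v (z h k.+1) - v (z h k)).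
  rewrite -(big_mkord xpredT (fun k => v (z h k.+1) - v (z h k))) telescope_sumr//.
  congr (v (_ + _) - v _).
    by apply/rowP => j; rewrite !mxE ltn_ord.
  by apply/rowP => j; rewrite !mxE ltn0 add0r.
have -> : l - h^-1 *: \sum_(k < n) (v (z h k.+1) - v (z h k)) =
  - h^-1 * \sum_(k < n) (v (z h k.+1) - v (z h k) - h * w ord0 k * partial k v x).
  have hl : \sum_(i < n) h * w ord0 i * partial i v x = h * l.
    by rewrite mulr_sumr; apply: eq_bigr => i _; rewrite mulrA.
  rewrite [in RHS]sumrB hl /GRing.scale/= mulrBr mulNr mulNr opprK.
  by rewrite mulrA mulVf// mul1r addrC.
rewrite normrM normrN normfV ler_pdivrMl ?normr_gt0//.
rewrite (le_trans (ler_norm_sum _ _ _))//.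
rewrite (le_trans (ler_sum _ (fun k _ => step k)))//.
rewrite -mulr_sumr ler_wpM2l// -mulr_suml mulrCA ler_piMr ?ltW//.
by rewrite ltr_pdivrMr// mul1r /M ltrDr.
Unshelve. all: by end_near. Qed.

(** * Inward rays and the normal derivative *)

(** At a point [x] of the sphere, [l] is the derivative of [v] along the ray from
[x] to the centre, as a limit of derivatives at interior points.  The derivative
at [x] itself is avoided since [v] is arbitrary outside the closed ball. *)
Definition inward_slope (R : realType) (n : nat) (v : 'rV[R]_n -> R)
    (x : 'rV[R]_n) (l : R) : Prop :=
  v (s *: (- x) + x) @[s --> (0:R)^'+] --> v x /\
  exists2 g1 : R -> R,
    \forall s \near (0:R)^'+, is_derive (s:R) 1 (fun s => v (s *: (- x) + x)) (g1 s) &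
    g1 s @[s --> (0:R)^'+] --> l.

Lemma cvg_to_within (T U : Type) (F : set_system T) (G : set_system U)
    (f : T -> U) (A : set U) :
  Filter F -> f @ F --> G -> (\forall x \near F, A (f x)) -> f @ F --> within A G.
Proof.
move=> FF fG fA P /fG GP.
exact: (@filterS2 T F FF _ _ (fun x => P (f x)) (fun x Ax H => H Ax) fA GP).
Qed.

Lemma cvg_inward_ray (R : realType) (n : nat) (r : R) (x : 'rV[R]_n) :
  0 < r -> esphere r x ->
  s *: (- x) + x @[s --> (0:R)^'+] --> within (oball r) (nbhs x).
Proof.
move=> r0 xr; apply: cvg_to_within.
  apply: (@cvg_within_filter _ _ _ (nbhs (0:R))).
  by have := @line_continuous R n (- x) x 0; rewrite /continuous_at scale0r add0r.
near=> s.
have s0 : 0 < s by near: s; exact: nbhs_right_gt.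
have s1 : s < 1 by near: s; exact: nbhs_right_lt.
rewrite /oball/= (_ : s *: - x + x = (1 - s) *: x).
  by rewrite enormZ xr ger0_norm ?subr_ge0 ?ltW// gtr_pMl// gtrBl.
by rewrite scalerBl scale1r scalerN addrC.
Unshelve. all: by end_near. Qed.

Lemma oball_sub_cball (R : realType) (n : nat) (r : R) (x : 'rV[R]_n) :
  oball r x -> cball r x.
Proof. exact: ltW. Qed.

Lemma esphere_sub_cball (R : realType) (n : nat) (r : R) (x : 'rV[R]_n) :
  esphere r x -> cball r x.
Proof. by rewrite /cball/= => ->. Qed.

Lemma cvg_inward_ray_cball (R : realType) (n : nat) (r : R) (x : 'rV[R]_n) :
  0 < r -> esphere r x ->
  s *: (- x) + x @[s --> (0:R)^'+] --> within (cball r) (nbhs x).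
Proof.
move=> r0 xr; apply: (cvg_trans (cvg_inward_ray r0 xr)).
by apply: within_subset => y; exact: oball_sub_cball.
Qed.

(** A limit over the neighbourhoods of [x] within an open set containing [x]
is attained by the value at [x]. *)
Lemma extends_continuously_at (R : realType) (n : nat) (r : R)
    (f : 'rV[R]_n -> R) (x : 'rV[R]_n) :
  extends_continuously (oball r) (cball r) f -> oball r x ->
  f y @[y --> x] --> f x.
Proof.
move=> + xr => /(_ x (oball_sub_cball xr)) /cvg_ex[l].
rewrite within_interior; last by rewrite ((interior_id _).1 (@open_oball R n r)).
move=> fl; suff -> : f x = l by [].
apply/eqP; rewrite -subr_eq0 -normr_eq0; apply/negPn/negP => fxl.
have e0 : 0 < `|l - f x| by rewrite lt_def distrC fxl/=.
by have /cvgrPdist_lt/(_ _ e0)/nbhs_singleton := fl; rewrite ltxx.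
Qed.

Record C1_on_cball (R : realType) (n : nat) (r : R) (v : 'rV[R]_n -> R) : Prop := {
  C1_continuous : {within cball r, continuous v} ;
  C1_derivable : forall (i : 'I_n) x, oball r x -> derivable v x (delta_mx ord0 i) ;
  C1_extends : forall i : 'I_n,
    extends_continuously (oball r) (cball r) (partial i v)
}.

Lemma cvg_along_inward_ray (R : realType) (n : nat) (r : R) (v : 'rV[R]_n -> R)
    (x : 'rV[R]_n) :
  0 < r -> {within cball r, continuous v} -> esphere r x ->
  v (s *: (- x) + x) @[s --> (0:R)^'+] --> v x.
Proof.
move=> r0 /subspace_continuousP cv xr.
apply: cvg_trans (cv x (esphere_sub_cball xr)).
exact: (cvg_app v (cvg_inward_ray_cball r0 xr)).
Qed.

(** The chain rule gives the derivative along the ray in terms of the partial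
derivatives, whose limits at the sphere define the normal derivative.  The
factor [r] comes from the ray being parametrised by [s] in [0, 1]. *)
Lemma inward_slope_normal_derivative (R : realType) (n : nat) (r : R)
    (v : 'rV[R]_n -> R) (x : 'rV[R]_n) :
  0 < r -> C1_on_cball r v -> esphere r x ->
  inward_slope v x (- (r * normal_derivative r v x)).
Proof.
move=> r0 [cv dv ev] xr; split; first exact: cvg_along_inward_ray cv xr.
exists (fun s => \sum_(i < n) (- x) ord0 i * partial i v (s *: (- x) + x)).
  have ray : \forall s \near (0:R)^'+, oball r (s *: (- x) + x).
    have := @cvg_inward_ray R n r x r0 xr (oball r).
    by apply; exact: withinT.
  near=> s; apply: is_derive_line.
  have sr : oball r (s *: (- x) + x) by near: s.
  apply: is_derive_of_partials => i.
    apply: (@filterS _ _ (nbhs_filter _) _ _ _ (oball_near sr)) => y; exact: dv.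
  exact: extends_continuously_at (ev i) sr.
rewrite /normal_derivative mulr_sumr -sumrN.
apply: cvg_sumr => i.
have -> : - (r * (cball_ext r (partial i v) x * (x ord0 i / r))) =
    (- x) ord0 i * cball_ext r (partial i v) x.
  by rewrite mxE; field; rewrite gt_eqF.
apply: cvgMl_tmp.
have /cvg_ex[l hl] := ev i x (esphere_sub_cball xr).
have pf : ProperFilter (within (oball r) (nbhs x)).
  split; last exact: within_filter.
  by move=> /(cvg_inward_ray r0 xr) /filter_ex[].
rewrite /cball_ext (cvg_lim _ hl)//.
apply: cvg_trans hl.
exact: (cvg_app (partial i v) (cvg_inward_ray r0 xr)).
Unshelve. all: by end_near. Qed.

Lemma cball_ext_interior (R : realType) (n : nat) (r : R) (f : 'rV[R]_n -> R)
    (x : 'rV[R]_n) :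
  oball r x -> f y @[y --> x] --> f x -> cball_ext r f x = f x.
Proof.
move=> xr fx; rewrite /cball_ext within_interior; last first.
  by rewrite ((interior_id _).1 (@open_oball R n r)).
exact: cvg_lim fx.
Qed.

(** The joint limit in (x, t) contains the limit at fixed [t], which is the one used
by the normal derivative. *)
Lemma extends_continuously_slice (R : realType) (n : nat) (A B : set 'rV[R]_n)
    (I : set R) (f : 'rV[R]_n * R -> R) (t : R) :
  extends_continuously (A `*` I) (B `*` I) f -> I t ->
  extends_continuously A B (fun x => f (x, t)).
Proof.
move=> ef It x Bx; have /cvg_ex[l hl] := ef (x, t) (conj Bx It).
apply/cvg_ex; exists l; apply: cvg_trans hl.
apply: (@cvg_app _ _ ((fun y => (y, t)) @ within A (nbhs x))
  (within (A `*` I) (nbhs (x, t))) f).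
apply: cvg_to_within.
  apply: (@cvg_within_filter _ _ _ (nbhs x)).
  by apply: (@cvg_pair _ _ _ (nbhs x) (nbhs x) (nbhs t) (nbhs_filter x));
    [exact: cvg_id|exact: (@cvg_cst _ _ _ _ (nbhs_filter x))].
have := withinT A (nbhs_filter x).
by apply: filterS => y Ay; split.
Qed.

(** * Jets along coordinate lines, and their analogues on rays *)

(** [p] and [q] are the first and second derivatives of [v] at [x] in the [i]-th
coordinate direction.  Recording only one line through [x] makes sums, multiples
and exponentials a matter of one-variable calculus. *)
Definition coord_jet2 (R : realType) (n : nat) (v : 'rV[R]_n -> R)
    (x : 'rV[R]_n) (i : 'I_n) (p q : R) : Prop :=
  exists2 g1 : R -> R,
    \forall s \near (0:R),
      is_derive (s:R) 1 (fun s => v (s *: delta_mx ord0 i + x)) (g1 s) &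
    g1 0 = p /\ is_derive (0:R) 1 g1 q.

Lemma is_derive_addf (R : realType) (f g : R -> R) (s a b : R) :
  is_derive s 1 f a -> is_derive s 1 g b ->
  is_derive s 1 (fun y => f y + g y) (a + b).
Proof. exact: is_deriveD. Qed.

Lemma is_derive_mulf (R : realType) (f g : R -> R) (s a b : R) :
  is_derive s 1 f a -> is_derive s 1 g b ->
  is_derive s 1 (fun y => f y * g y) (f s * b + g s * a).
Proof. exact: is_deriveM. Qed.

Lemma is_derive_scalef (R : realType) (f : R -> R) (k s a : R) :
  is_derive s 1 f a -> is_derive s 1 (fun y => k * f y) (k * a).
Proof. exact: is_deriveZ. Qed.

Lemma is_derive_expRf (R : realType) (f : R -> R) (s a : R) :
  is_derive s 1 f a -> is_derive s 1 (fun y => expR (f y)) (expR (f s) * a).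
Proof. by move=> fa; apply: is_derive1_comp. Qed.

Lemma is_derive_quadratic (R : realType) (f : R -> R) (a b c s : R) :
  (forall y, f y = a + b * y + c * y ^+ 2) -> is_derive s 1 f (b + 2 * c * s).
Proof.
move=> /funext ->.
have d2 : is_derive s 1 (fun y : R => y ^+ 2) (s * 1 + s * 1).
  under eq_fun do rewrite expr2.
  exact: (is_derive_mulf (is_derive_id _ _) (is_derive_id _ _)).
have d1 : is_derive s 1 (fun y : R => a + b * y) (0 + b * 1).
  exact: (is_derive_addf (is_derive_cst _ _ _)
    (is_derive_scalef b (is_derive_id _ _))).
apply: (is_derive_eq (is_derive_addf d1 (is_derive_scalef c d2))).
by ring.
Qed.

Section Jets.
Context {R : realType} {n : nat}.
Implicit Types (v w : 'rV[R]_n -> R) (x : 'rV[R]_n) (i : 'I_n).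

Lemma coord_jet2_cst (c : R) x i : coord_jet2 (fun=> c) x i 0 0.
Proof.
exists (fun=> 0); last by split => //; exact: is_derive_cst.
by near=> s; exact: is_derive_cst.
Unshelve. all: by end_near. Qed.

Lemma coord_jet2D v w x i p q p' q' :
  coord_jet2 v x i p q -> coord_jet2 w x i p' q' ->
  coord_jet2 (fun y => v y + w y) x i (p + p') (q + q').
Proof.
move=> [g1 dg [<- dg1]] [h1 dh [<- dh1]].
exists (fun s => g1 s + h1 s); last by split => //; exact: is_derive_addf.
by near=> s; apply: is_derive_addf; near: s.
Unshelve. all: by end_near. Qed.

Lemma coord_jet2Z (k : R) v x i p q :
  coord_jet2 v x i p q -> coord_jet2 (fun y => k * v y) x i (k * p) (k * q).
Proof.
move=> [g1 dg [<- dg1]].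
exists (fun s => k * g1 s); last by split => //; exact: is_derive_scalef.
by near=> s; apply: is_derive_scalef; near: s.
Unshelve. all: by end_near. Qed.

Lemma coord_jet2_expR v x i p q :
  coord_jet2 v x i p q ->
  coord_jet2 (fun y => expR (v y)) x i (expR (v x) * p) (expR (v x) * (q + p ^+ 2)).
Proof.
move=> [g1 dg [<- dg1]].
exists (fun s => expR (v (s *: delta_mx ord0 i + x)) * g1 s).
  by near=> s; apply: is_derive_expRf; near: s.
rewrite scale0r add0r; split => //.
have dv := is_derive_expRf (nbhs_singleton dg).
apply: (is_derive_eq (is_derive_mulf dv dg1)).
by rewrite scale0r add0r; ring.
Unshelve. all: by end_near. Qed.

Lemma coord_jet2_sqr_enorm x i :
  coord_jet2 (fun y => enorm y ^+ 2) x i (2 * x ord0 i) 2.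
Proof.
exists (fun s => 2 * x ord0 i + 2 * s).
  near=> s; rewrite -[X in _ + X * s](mulr1 2).
  apply: (@is_derive_quadratic _ _ (enorm x ^+ 2)) => y.
  by rewrite sqr_enorm_coord; ring.
rewrite mulr0 addr0; split => //.
have := @is_derive_quadratic R (fun s => 2 * x ord0 i + 2 * s) (2 * x ord0 i) 2 0 0.
by rewrite !mulr0 addr0; apply => y; ring.
Unshelve. all: by end_near. Qed.

Lemma coord_jet2_min v x i p q :
  coord_jet2 v x i p q ->
  (\forall s \near (0:R), v x <= v (s *: delta_mx ord0 i + x)) -> p = 0 /\ 0 <= q.
Proof.
move=> [g1 dg [<- dg1]] vmin; apply: (min_second_derivative dg dg1).
by rewrite scale0r add0r.
Qed.

Lemma inward_slope_cst (c : R) x : inward_slope (fun=> c) x 0.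
Proof.
split; first exact: cvg_cst.
exists (fun=> 0); last exact: cvg_cst.
by near=> s; exact: is_derive_cst.
Unshelve. all: by end_near. Qed.

Lemma inward_slopeD v w x l l' :
  inward_slope v x l -> inward_slope w x l' ->
  inward_slope (fun y => v y + w y) x (l + l').
Proof.
move=> [cv [g1 dg gl]] [cw [h1 dh hl]]; split; first exact: cvgD.
exists (fun s => g1 s + h1 s); last exact: cvgD.
by near=> s; apply: is_derive_addf; near: s.
Unshelve. all: by end_near. Qed.

Lemma inward_slopeZ (k : R) v x l :
  inward_slope v x l -> inward_slope (fun y => k * v y) x (k * l).
Proof.
move=> [cv [g1 dg gl]]; split; first exact: cvgMl_tmp.
exists (fun s => k * g1 s); last exact: cvgMl_tmp.
by near=> s; apply: is_derive_scalef; near: s.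
Unshelve. all: by end_near. Qed.

Lemma inward_slope_expR v x l :
  inward_slope v x l ->
  inward_slope (fun y => expR (v y)) x (expR (v x) * l).
Proof.
move=> [cv [g1 dg gl]].
have ce : expR (v (s *: - x + x)) @[s --> (0:R)^'+] --> expR (v x).
  by apply: continuous_cvg => //; exact: continuous_expR.
split => //; exists (fun s => expR (v (s *: - x + x)) * g1 s); last exact: cvgM.
by near=> s; apply: is_derive_expRf; near: s.
Unshelve. all: by end_near. Qed.

Lemma inward_slope_sqr_enorm x :
  inward_slope (fun y => enorm y ^+ 2) x (- 2 * enorm x ^+ 2).
Proof.
have E s : enorm (s *: - x + x) ^+ 2 = (1 - s) ^+ 2 * enorm x ^+ 2.
  rewrite (_ : s *: - x + x = (1 - s) *: x); last first.
    by rewrite scalerBl scale1r scalerN addrC.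
  by rewrite enormZ exprMn real_normK ?num_real.
have dE (s : R) : is_derive s 1 (fun s => enorm (s *: - x + x) ^+ 2)
    (- 2 * (1 - s) * enorm x ^+ 2).
  rewrite (_ : - 2 * (1 - s) * enorm x ^+ 2 =
    (- 2 * enorm x ^+ 2) + 2 * (enorm x ^+ 2) * s); last by ring.
  by apply: (@is_derive_quadratic _ _ (enorm x ^+ 2)) => y; rewrite E; ring.
split.
  rewrite [X in _ --> X](_ : _ = enorm (0 *: - x + x) ^+ 2); last first.
    by rewrite scale0r add0r.
  exact/cvg_at_right_filter/(is_derive_continuous (dE 0)).
exists (fun s => - 2 * (1 - s) * enorm x ^+ 2).
  by near=> s; exact: dE.
apply: cvg_at_right_filter.
rewrite [X in _ --> X](_ : _ = - 2 * (1 - 0) * enorm x ^+ 2); last by rewrite subr0 mulr1.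
have d1 : is_derive (0:R) 1 (fun s => - 2 * (1 - s) * enorm x ^+ 2) (2 * enorm x ^+ 2).
  have := @is_derive_quadratic R (fun s => - 2 * (1 - s) * enorm x ^+ 2)
    (- 2 * enorm x ^+ 2) (2 * enorm x ^+ 2) 0 0.
  by rewrite !mulr0 addr0; apply => y; ring.
exact: is_derive_continuous d1.
Unshelve. all: by end_near. Qed.

Lemma inward_slope_min (v : 'rV[R]_n -> R) x l :
  inward_slope v x l -> (\forall s \near (0:R)^'+, v x <= v (s *: - x + x)) -> 0 <= l.
Proof.
move=> [cv [g1 dg gl]] vmin.
apply: (right_min_deriv_lim_ge0 _ dg gl); rewrite scale0r add0r//.
Qed.

End Jets.

(** * Minima over a space-time cylinder *)

(** The regularity used at a minimum over [0, tau]: two spatial derivatives and one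
time derivative inside, first-order spatial regularity up to the sphere. *)
Record heat_regular (R : realType) (n : nat) (r tau : R)
    (U : 'rV[R]_n -> R -> R) : Prop := {
  hr_continuous : {within cball r `*` `[0, tau], continuous
    (fun z : 'rV[R]_n * R => U z.1 z.2)} ;
  hr_C1 : forall t : R, 0 < t <= tau -> C1_on_cball r (U ^~ t) ;
  hr_derivable_xx : forall (i : 'I_n) x (t : R), oball r x -> 0 < t <= tau ->
    derivable (partial i (U ^~ t)) x (delta_mx ord0 i) ;
  hr_derivable_t : forall x (t : R), oball r x -> 0 < t <= tau -> derivable (U x) t 1
}.

Section Parabolic.
Context {R : realType} {n : nat}.
Variables (r tau : R).
Hypotheses (r0 : 0 < r) (tau0 : 0 <= tau).
Implicit Types (U V W : 'rV[R]_n -> R -> R) (x : 'rV[R]_n).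

Local Notation cylinder := (cball r `*` `[0, tau] : set ('rV[R]_n * R)).

Lemma coord_jet2_partial U x t (i : 'I_n) :
  heat_regular r tau U -> oball r x -> 0 < t <= tau ->
  coord_jet2 (U ^~ t) x i (partial i (U ^~ t) x)
    (partial i (partial i (U ^~ t)) x).
Proof.
move=> regU xr tt.
have near_in : \forall s \near (0:R), oball r (s *: delta_mx ord0 i + x).
  have := @line_continuous R n (delta_mx ord0 i) x 0; rewrite /continuous_at.
  rewrite scale0r add0r => /(_ _ (oball_near xr)).
  exact.
exists (fun s => partial i (U ^~ t) (s *: delta_mx ord0 i + x)).
  near=> s; apply: (@is_derive_line R n (U ^~ t)); apply: derivableP.
  by apply: (C1_derivable (hr_C1 regU tt)); near: s.
rewrite scale0r add0r; split; first by [].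
apply: (@is_derive_line R n (partial i (U ^~ t))); rewrite scale0r add0r.
exact: (derivableP (@hr_derivable_xx _ _ _ _ _ regU i x t xr tt)).
Unshelve. all: by end_near. Qed.

Lemma cylinder_min W : {within cylinder, continuous (fun z => W z.1 z.2)} ->
  exists x t, [/\ cball r x, 0 <= t <= tau &
    forall y s, cball r y -> 0 <= s <= tau -> W x t <= W y s].
Proof.
move=> cW.
have [||[x t] + Wmin] := compact_EVT_min _ _ cW.
- by exists (0, 0); split; rewrite /= /cball/= ?in_itv/= ?lexx ?enorm0// ltW.
- by apply: compact_setX; [exact: compact_cball|exact: segment_compact].
rewrite inE => -[/= xr]; rewrite in_itv/= => tt.
exists x, t; split => // y s yr ss; apply: (Wmin (y, s)).
by rewrite inE; split => //=; rewrite in_itv.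
Qed.

Variables (W : 'rV[R]_n -> R -> R) (x : 'rV[R]_n) (t : R).
Hypotheses (tt : 0 <= t <= tau)
  (Wmin : forall y s, cball r y -> 0 <= s <= tau -> W x t <= W y s).

Lemma cylinder_min_jet (i : 'I_n) p q :
  oball r x -> coord_jet2 (W ^~ t) x i p q -> p = 0 /\ 0 <= q.
Proof.
move=> xr /coord_jet2_min; apply.
have := @line_continuous R n (delta_mx ord0 i) x 0; rewrite /continuous_at.
rewrite scale0r add0r => /(_ _ (oball_near xr)) H.
near=> s; have sr : oball r (s *: delta_mx ord0 i + x) by near: s; exact: H.
by apply: Wmin => //; exact: oball_sub_cball.
Unshelve. all: by end_near. Qed.

Lemma cylinder_min_slope l :
  esphere r x -> inward_slope (W ^~ t) x l -> 0 <= l.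
Proof.
move=> xr /inward_slope_min; apply.
have := @cvg_inward_ray_cball R n r x r0 xr (cball r) (withinT _ _).
move=> H; near=> s.
have sr : cball r (s *: - x + x) by near: s; exact: H.
exact: Wmin.
Unshelve. all: by end_near. Qed.

Lemma cylinder_min_time l :
  cball r x -> 0 < t -> is_derive t 1 (W x) l -> l <= 0.
Proof.
move=> xr t0 /(left_min_deriv_le0 t0); apply => s s0 st.
by apply: Wmin => //; rewrite s0 (le_trans st)//; case/andP: tt.
Qed.

End Parabolic.

(** * Comparison with a Lipschitz flux *)

(** Each hypothesis concerns a second derivative of U - V + m e^(lambda t + mu |x|^2)
at a point with coordinates [X] where the exponential equals [e], in the form in
which the rules for jets produce it. *)
Lemma sum_barrier_jet_ge0 (R : realType) (n : nat) (P Q X : 'I_n -> R)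
    (m e mu : R) :
  (forall i, 0 <= P i + (-1) * (Q i + 0) +
     m * (e * ((0 + mu * 2) + (0 + mu * (2 * X i)) ^+ 2))) ->
  0 <= \sum_(i < n) P i - \sum_(i < n) Q i +
    m * e * (2 * mu * n%:R + 4 * mu ^+ 2 * \sum_(i < n) X i ^+ 2).
Proof.
move=> H.
suff -> : \sum_(i < n) P i - \sum_(i < n) Q i +
    m * e * (2 * mu * n%:R + 4 * mu ^+ 2 * \sum_(i < n) X i ^+ 2) =
    \sum_(i < n) (P i + (-1) * (Q i + 0) +
      m * (e * ((0 + mu * 2) + (0 + mu * (2 * X i)) ^+ 2))).
  by apply: sumr_ge0 => i _; exact: H.
rewrite -sumrB [in LHS]mulr_sumr.
have -> : 2 * mu * n%:R = \sum_(i < n) 2 * mu.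
  by rewrite sumr_const card_ord mulr_natr.
rewrite -big_split/= mulr_sumr -big_split/=.
by apply: eq_bigr => i _; ring.
Qed.

Section Comparison.
Context {R : realType} {n : nat}.
Variables (r tau L c b : R) (U V : 'rV[R]_n -> R -> R).
Hypotheses (r0 : 0 < r) (tau0 : 0 <= tau)
  (regU : heat_regular r tau U) (regV : heat_regular r tau V)
  (UV_init : forall x, cball r x -> V x 0 + b <= U x 0)
  (UV_heat : forall x t, oball r x -> 0 < t <= tau ->
     derive1 (V x) t + c - laplacian (V ^~ t) x <=
     derive1 (U x) t - laplacian (U ^~ t) x)
  (UV_flux : forall x t, esphere r x -> 0 < t <= tau ->
     U x t < V x t + (c * t + b) ->
     L * (U x t - (V x t + (c * t + b))) <=
     normal_derivative r (U ^~ t) x - normal_derivative r (V ^~ t) x).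

(* [mu] makes the outward logarithmic derivative of the barrier, 2 mu r, exceed
   [L]; [lambda] makes the barrier a strict supersolution of the heat equation. *)
Let mu := (`|L| + 1) / (2 * r).
Let lambda := 2 * mu * n%:R + 4 * mu ^+ 2 * r ^+ 2 + 1.
Let barrier (x : 'rV[R]_n) (t : R) := expR (lambda * t + mu * enorm x ^+ 2).

(** If the conclusion fails, the ratio of the difference [d] and the barrier has a
minimum [- m < 0].  There [d + m * barrier] attains its minimum 0, and the strict
inequalities satisfied by the barrier contradict the first- and second-order
conditions: at the sphere the growth [2 mu r > L] of the barrier beats the
Lipschitz loss of the flux. *)
Lemma comparison x t :
  cball r x -> 0 <= t <= tau -> V x t + (c * t + b) <= U x t.
Proof.
pose d (x : 'rV[R]_n) (t : R) := U x t - (V x t + (c * t + b)).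
have mu0 : 0 < mu by rewrite divr_gt0 ?mulr_gt0// ltr_pwDr.
pose W (x : 'rV[R]_n) (t : R) := d x t * expR (- (lambda * t + mu * enorm x ^+ 2)).
have [x0 [t0 [x0r tt0 Wmin]]] : exists x t, [/\ cball r x, 0 <= t <= tau &
    forall y s, cball r y -> 0 <= s <= tau -> W x t <= W y s].
  apply: cylinder_min => //.
  have caff : continuous (fun z : 'rV[R]_n * R => c * z.2 + b).
    move=> z; apply: cvgD; last exact: cvg_cst.
    by apply: cvgMl_tmp; exact: cvg_snd.
  have csqr : continuous (fun z : 'rV[R]_n * R => enorm z.1 ^+ 2).
    move=> z; apply: (@continuous_comp _ _ _ (fun z : 'rV[R]_n * R => enorm z.1)
      (fun s : R => s ^+ 2)); last exact: exprn_continuous.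
    apply: (@continuous_comp _ _ _ fst (@enorm R n)); first exact: cvg_fst.
    exact: enorm_continuous.
  have cexp : continuous (fun z : 'rV[R]_n * R =>
      expR (- (lambda * z.2 + mu * enorm z.1 ^+ 2))).
    move=> z; apply: continuous_cvg; first exact: continuous_expR.
    apply: cvgN; apply: cvgD; first by apply: cvgMl_tmp; exact: cvg_snd.
    by apply: cvgMl_tmp; exact: csqr.
  move=> z; apply: cvgM; last exact: (continuous_subspaceT cexp).
  apply: cvgB; first exact: (hr_continuous regU).
  apply: cvgD; first exact: (hr_continuous regV).
  exact: (continuous_subspaceT caff).
have [W0|W0] := leP 0 (W x0 t0).
  move=> xr tt; have := le_trans W0 (Wmin _ _ xr tt).
  by rewrite /W pmulr_lge0 ?expR_gt0// subr_ge0.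
exfalso.
pose m := - W x0 t0.
have m0 : 0 < m by rewrite oppr_gt0.
pose psi (x : 'rV[R]_n) (t : R) := d x t + m * barrier x t.
have psiE y s : psi y s = (W y s + m) * barrier y s.
  by rewrite mulrDl /W -mulrA -expRD addNr expR0 mulr1.
have b0 y s : 0 < barrier y s by exact: expR_gt0.
have psi0 : psi x0 t0 = 0 by rewrite psiE /m subrr mul0r.
have psimin y s : cball r y -> 0 <= s <= tau -> psi x0 t0 <= psi y s.
  move=> yr ss; rewrite psi0 psiE mulr_ge0 ?(ltW (b0 _ _))//.
  by rewrite subr_ge0 Wmin.
have d0 : d x0 t0 = - (m * barrier x0 t0).
  by apply/eqP; rewrite -addr_eq0; exact/eqP.
have dneg : d x0 t0 < 0 by rewrite d0 oppr_lt0 mulr_gt0.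
have t0_gt0 : 0 < t0.
  case/andP: tt0 => t00 _; rewrite lt_neqAle t00 andbT.
  apply: contraTneq dneg => <-; rewrite -leNgt /d mulr0 add0r subr_ge0.
  exact: UV_init.
have tt0' : 0 < t0 <= tau by rewrite t0_gt0; case/andP: tt0.
have [x0s|x0in] := eqVneq (enorm x0) r.
  have slope : inward_slope (psi ^~ t0) x0
      (- (r * normal_derivative r (U ^~ t0) x0) +
       (-1) * (- (r * normal_derivative r (V ^~ t0) x0) + 0) +
       m * (barrier x0 t0 * (0 + mu * (- 2 * enorm x0 ^+ 2)))).
    have -> : psi ^~ t0 = fun y => (U y t0 + (-1) * (V y t0 + (c * t0 + b))) +
        m * expR (lambda * t0 + mu * enorm y ^+ 2).
      by apply/funext => y; rewrite /psi /d mulN1r.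
    apply: inward_slopeD; last first.
      apply/inward_slopeZ/inward_slope_expR/inward_slopeD.
        exact: inward_slope_cst.
      exact/inward_slopeZ/inward_slope_sqr_enorm.
    apply: inward_slopeD.
      exact/inward_slope_normal_derivative/x0s/hr_C1/tt0'.
    apply/inward_slopeZ/inward_slopeD; last exact: inward_slope_cst.
    exact/inward_slope_normal_derivative/x0s/hr_C1/tt0'.
  have := cylinder_min_slope r0 tt0 psimin x0s slope.
  have := UV_flux x0s tt0'; rewrite -subr_lt0 -/(d x0 t0) => /(_ dneg).
  rewrite x0s d0 => flux; apply/negP; rewrite -ltNge.
  have mb : 0 < m * barrier x0 t0 by rewrite mulr_gt0.
  have muE : 2 * mu * r = `|L| + 1 by rewrite /mu; field; rewrite gt_eqF.
  have -> : m * (barrier x0 t0 * (0 + mu * (-2 * r ^+ 2))) =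
    - (r * (2 * mu * r) * (m * barrier x0 t0)) by ring.
  rewrite muE; have LL := ler_norm L.
  set A := normal_derivative _ _ _ in flux *.
  set B := normal_derivative _ _ _ in flux *.
  set M := m * _ in flux mb *.
  have : r * (L * - M) <= r * (A - B) by rewrite ler_pM2l.
  have : r * (L * M) <= r * (`|L| * M) by rewrite ler_pM2l// ler_wpM2r// ltW.
  have : 0 < r * M by rewrite mulr_gt0.
  lra.
have {}x0in : oball r x0 by rewrite /oball/= lt_neqAle x0in.
have jet i : coord_jet2 (psi ^~ t0) x0 i
   (partial i (U ^~ t0) x0 + (-1) * (partial i (V ^~ t0) x0 + 0) +
     m * (barrier x0 t0 * (0 + mu * (2 * x0 ord0 i))))
   (partial i (partial i (U ^~ t0)) x0 + (-1) * (partial i (partial i (V ^~ t0)) x0 + 0) +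
     m * (barrier x0 t0 * ((0 + mu * 2) + (0 + mu * (2 * x0 ord0 i)) ^+ 2))).
  have -> : psi ^~ t0 = fun y => (U y t0 + (-1) * (V y t0 + (c * t0 + b))) +
      m * expR (lambda * t0 + mu * enorm y ^+ 2).
    by apply/funext => y; rewrite /psi /d mulN1r.
  apply: coord_jet2D; last first.
    apply/coord_jet2Z/coord_jet2_expR/coord_jet2D.
      exact: coord_jet2_cst.
    exact/coord_jet2Z/coord_jet2_sqr_enorm.
  apply: coord_jet2D; first exact: coord_jet2_partial regU x0in tt0'.
  apply/coord_jet2Z/coord_jet2D; last exact: coord_jet2_cst.
  exact: coord_jet2_partial regV x0in tt0'.
have lap : 0 <= laplacian (U ^~ t0) x0 - laplacian (V ^~ t0) x0 +
    m * barrier x0 t0 * (2 * mu * n%:R + 4 * mu ^+ 2 * enorm x0 ^+ 2).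
  rewrite sqr_enorm; apply: sum_barrier_jet_ge0 => i.
  by have [] := cylinder_min_jet tt0 psimin x0in (jet i).
have dpsi : is_derive t0 1 (psi x0)
    (derive1 (U x0) t0 + (-1) * (derive1 (V x0) t0 + c) +
     m * (barrier x0 t0 * lambda)).
  have -> : psi x0 = fun s => (U x0 s + (-1) * (V x0 s + (c * s + b))) +
      m * expR (lambda * s + mu * enorm x0 ^+ 2).
    by apply/funext => y; rewrite /psi /d mulN1r.
  have daff k0 k1 : is_derive t0 1 (fun s => k1 * s + k0) k1.
    have := @is_derive_quadratic R (fun s => k1 * s + k0) k0 k1 0 t0.
    by rewrite mulr0 mul0r addr0; apply => y; ring.
  have dU := derivableP (hr_derivable_t regU x0in tt0').
  have dV := derivableP (hr_derivable_t regV x0in tt0').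
  rewrite !derive1E.
  exact: (is_derive_addf
    (is_derive_addf dU (is_derive_scalef (-1) (is_derive_addf dV (daff _ _))))
    (is_derive_scalef m (is_derive_expRf (daff _ _)))).
have := cylinder_min_time tt0 psimin x0r t0_gt0 dpsi.
apply/negP; rewrite -ltNge.
have := UV_heat x0in tt0'.
have mb : 0 < m * barrier x0 t0 by rewrite mulr_gt0.
have : enorm x0 ^+ 2 <= r ^+ 2 by rewrite ler_sqr ?nnegrE ?enorm_ge0 ?(ltW r0).
have := sqr_ge0 mu.
rewrite [m * (_ * lambda)]mulrA /lambda; move: lap mb.
set A := laplacian _ _; set B := laplacian _ _; set M := m * _.
set e := enorm x0 ^+ 2; set mu2 := mu ^+ 2.
move=> lap M0 mu20 er heat.
have : M * (4 * mu2 * e) <= M * (4 * mu2 * r ^+ 2).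
  by rewrite ler_pM2l// ler_wpM2l// mulr_ge0.
lra.
Qed.

End Comparison.

(** * Comparison of exponentials of two heat solutions *)

(** [A] and [B] stand for exp (- k V) and exp (- k U).  At a critical point of the
difference, A vi = B ui, hence A vi^2 = B^2 ui^2 / A <= B ui^2 since B < A: the
quadratic terms can be dropped. *)
Lemma exp_jet_ineq (R : realType) (k A B vi ui vii uii : R) :
  0 < k -> 0 < B -> B < A ->
  A * (- k * vi) + (-1) * (B * (- k * ui)) + 0 = 0 ->
  0 <= A * (- k * vii + (- k * vi) ^+ 2) +
    (-1) * (B * (- k * uii + (- k * ui) ^+ 2)) + 0 ->
  A * vii - B * uii <= 0.
Proof.
move=> k0 B0 BA p0 q0.
have AB : A * (k * vi) = B * (k * ui) by lra.
have sq : A * (k * vi) ^+ 2 <= B * (k * ui) ^+ 2.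
  rewrite -(ler_pM2l (lt_trans B0 BA)).
  have -> : A * (A * (k * vi) ^+ 2) = (A * (k * vi)) ^+ 2 by ring.
  rewrite AB (_ : _ ^+ 2 = B * (B * (k * ui) ^+ 2)); last by ring.
  by rewrite ler_wpM2r ?(ltW BA)// mulr_ge0 ?sqr_ge0// ltW.
rewrite -(ler_pM2l k0) mulr0; lra.
Qed.

Section ExpComparison.
Context {R : realType} {n : nat}.
Variables (r tau k eta : R) (U V : 'rV[R]_n -> R -> R).
Hypotheses (r0 : 0 < r) (tau0 : 0 <= tau) (k0 : 0 < k)
  (regU : heat_regular r tau U) (regV : heat_regular r tau V)
  (ltVU : forall x t, cball r x -> 0 <= t <= tau -> V x t < U x t)
  (heatU : forall x t, oball r x -> 0 < t <= tau ->
     derive1 (U x) t = laplacian (U ^~ t) x)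
  (heatV : forall x t, oball r x -> 0 < t <= tau ->
     derive1 (V x) t = laplacian (V ^~ t) x)
  (init : forall x, cball r x -> eta <= expR (- k * V x 0) - expR (- k * U x 0))
  (flux : forall x t, esphere r x -> 0 < t <= tau ->
     eta <= expR (- k * V x t) - expR (- k * U x t) \/
     normal_derivative r (V ^~ t) x * expR (- k * V x t) <
     normal_derivative r (U ^~ t) x * expR (- k * U x t)).

(** The perturbation [delta * s] turns the interior inequality into a strict
one; [delta] is small enough for the minimum to stay negative, which excludes the
points where the desired bound is known directly. *)
Lemma exp_comparison x t : cball r x -> 0 <= t <= tau ->
  eta <= expR (- k * V x t) - expR (- k * U x t).
Proof.
move=> xr tt; rewrite leNgt; apply/negP => lt_eta.
pose phi (x : 'rV[R]_n) (t : R) := expR (- k * V x t) + (-1) * expR (- k * U x t).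
have phiE y s : expR (- k * V y s) - expR (- k * U y s) = phi y s.
  by rewrite /phi mulN1r.
pose delta := (eta - phi x t) / (tau + 1).
have tau1 : 0 < tau + 1 by rewrite ltr_wpDl.
have delta0 : 0 < delta by rewrite divr_gt0// subr_gt0 -phiE.
pose W (x : 'rV[R]_n) (t : R) := phi x t + (delta * t - eta).
have Wxt : W x t < 0.
  have : delta * t <= delta * tau by rewrite ler_pM2l//; case/andP: tt.
  have : delta * tau < eta - phi x t.
    by rewrite -[ltRHS](divfK (lt0r_neq0 tau1)) -/delta ltr_pM2l// ltrDl.
  rewrite /W; lra.
have [x0 [t0 [x0r tt0 Wmin]]] : exists x t, [/\ cball r x, 0 <= t <= tau &
    forall y s, cball r y -> 0 <= s <= tau -> W x t <= W y s].
  apply: cylinder_min => //.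
  have caff : continuous (fun z : 'rV[R]_n * R => delta * z.2 - eta).
    move=> z; apply: cvgB; last exact: cvg_cst.
    by apply: cvgMl_tmp; exact: cvg_snd.
  have cexp (F : 'rV[R]_n -> R -> R) : heat_regular r tau F ->
      {within cball r `*` `[0, tau],
        continuous (fun z : 'rV[R]_n * R => expR (- k * F z.1 z.2))}.
    move=> regF z; apply: continuous_cvg; first exact: continuous_expR.
    by apply: cvgMl_tmp; exact: (hr_continuous regF).
  move=> z; apply: cvgD; last exact: (continuous_subspaceT caff).
  apply: cvgD; first exact: cexp.
  by apply: cvgMl_tmp; exact: cexp.
have W0 : W x0 t0 < 0 by apply: le_lt_trans Wxt; exact: Wmin.
have phi0 : phi x0 t0 < eta.
  have : 0 <= delta * t0 by rewrite mulr_ge0 ?(ltW delta0)//; case/andP: tt0.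
  by move: W0; rewrite /W; lra.
have t0_gt0 : 0 < t0.
  case/andP: tt0 => t00 _; rewrite lt_neqAle t00 andbT.
  apply: contraTneq phi0 => <-; rewrite -leNgt -phiE; exact: init.
have tt0' : 0 < t0 <= tau by rewrite t0_gt0; case/andP: tt0.
have [x0s|x0in] := eqVneq (enorm x0) r.
  have slope : inward_slope (W ^~ t0) x0
      (expR (- k * V x0 t0) * (- k * - (r * normal_derivative r (V ^~ t0) x0)) +
      (-1) * (expR (- k * U x0 t0) *
        (- k * - (r * normal_derivative r (U ^~ t0) x0))) + 0).
    apply: inward_slopeD; last exact: inward_slope_cst.
    apply: inward_slopeD.
      apply/inward_slope_expR/inward_slopeZ.
      exact/inward_slope_normal_derivative/x0s/hr_C1/tt0'.
    apply/inward_slopeZ/inward_slope_expR/inward_slopeZ.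
    exact/inward_slope_normal_derivative/x0s/hr_C1/tt0'.
  have := cylinder_min_slope r0 tt0 Wmin x0s slope; apply/negP; rewrite -ltNge.
  have [|lt_flux] := flux x0s tt0'; first by rewrite phiE leNgt phi0.
  have : 0 < k * r by rewrite mulr_gt0.
  set a := normal_derivative _ _ _ in lt_flux *.
  set b := normal_derivative _ _ _ in lt_flux *.
  move: lt_flux; rewrite -subr_gt0 => lt_flux kr0.
  have := mulr_gt0 kr0 lt_flux; lra.
have {}x0in : oball r x0 by rewrite /oball/= lt_neqAle x0in.
have jet i : coord_jet2 (W ^~ t0) x0 i
   (expR (- k * V x0 t0) * (- k * partial i (V ^~ t0) x0) +
     (-1) * (expR (- k * U x0 t0) * (- k * partial i (U ^~ t0) x0)) + 0)
   (expR (- k * V x0 t0) * (- k * partial i (partial i (V ^~ t0)) x0 +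
       (- k * partial i (V ^~ t0) x0) ^+ 2) +
     (-1) * (expR (- k * U x0 t0) * (- k * partial i (partial i (U ^~ t0)) x0 +
       (- k * partial i (U ^~ t0) x0) ^+ 2)) + 0).
  apply: coord_jet2D; last exact: coord_jet2_cst.
  apply: coord_jet2D.
    apply/coord_jet2_expR/coord_jet2Z.
    exact: coord_jet2_partial regV x0in tt0'.
  apply/coord_jet2Z/coord_jet2_expR/coord_jet2Z.
  exact: coord_jet2_partial regU x0in tt0'.
have A0 : 0 < expR (- k * V x0 t0) by exact: expR_gt0.
have B0 : 0 < expR (- k * U x0 t0) by exact: expR_gt0.
have BA : expR (- k * U x0 t0) < expR (- k * V x0 t0).
  by rewrite ltr_expR !mulNr ltrN2 ltr_pM2l// ltVU.
have lap : expR (- k * V x0 t0) * laplacian (V ^~ t0) x0 -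
    expR (- k * U x0 t0) * laplacian (U ^~ t0) x0 <= 0.
  rewrite !mulr_sumr -sumrB; apply: sumr_le0 => i _.
  have [p0 q0] := cylinder_min_jet tt0 Wmin x0in (jet i).
  exact: exp_jet_ineq p0 q0.
have dW : is_derive t0 1 (W x0)
    (expR (- k * V x0 t0) * (- k * derive1 (V x0) t0) +
     (-1) * (expR (- k * U x0 t0) * (- k * derive1 (U x0) t0)) + delta).
  have daff : is_derive t0 1 (fun s => delta * s - eta) delta.
    have := @is_derive_quadratic R (fun s => delta * s - eta) (- eta) delta 0 t0.
    by rewrite mulr0 mul0r addr0; apply => y; ring.
  have dU := derivableP (hr_derivable_t regU x0in tt0').
  have dV := derivableP (hr_derivable_t regV x0in tt0').
  rewrite !derive1E.
  exact: (is_derive_addf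
    (is_derive_addf (is_derive_expRf (is_derive_scalef (- k) dV))
      (is_derive_scalef (-1) (is_derive_expRf (is_derive_scalef (- k) dU)))) daff).
have := cylinder_min_time tt0 Wmin x0r t0_gt0 dW.
apply/negP; rewrite -ltNge heatU// heatV//.
move: (laplacian (V ^~ t0) x0) (laplacian (U ^~ t0) x0) lap => a b.
rewrite -(ler_pM2l k0); lra.
Qed.

End ExpComparison.

(** * Regularity of the solution and of the initial value *)

Section Solution.
Context {R : realType} {n : nat}.
Variables (r p T : R) (u0 : 'rV[R]_n -> R) (u : 'rV[R]_n -> R -> R).
Hypotheses (r0 : 0 < r) (sol : classical_solution r p T u0 u).

Lemma solution_slice_continuous (t : R) :
  0 <= t < T -> {within cball r, continuous (u ^~ t)}.
Proof.
move=> tT; apply/subspace_continuousP => x xr.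
have /subspace_continuousP cu := sol_continuous sol.
have xt : (cball r `*` `[0, T[) (x, t) by split; rewrite //= in_itv.
apply: cvg_trans (cu _ xt).
apply: (@cvg_app _ _ ((fun y => (y, t)) @ within (cball r) (nbhs x)) _
  (fun z : 'rV[R]_n * R => u z.1 z.2)).
apply: cvg_to_within.
  apply: (@cvg_within_filter _ _ _ (nbhs x)).
  by apply: (@cvg_pair _ _ _ (nbhs x) (nbhs x) (nbhs t) (nbhs_filter x));
    [exact: cvg_id|exact: (@cvg_cst _ _ _ _ (nbhs_filter x))].
have := withinT (cball r) (nbhs_filter x).
by apply: filterS => y Ay; split; rewrite //= in_itv.
Qed.

Lemma solution_slice_C1 (t : R) : 0 < t < T -> C1_on_cball r (u ^~ t).
Proof.
move=> tT; split.
- by apply: solution_slice_continuous; case/andP: tT => /ltW -> ->.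
- by move=> i x xr; apply: (sol_derivable_x sol).
- move=> i.
  have := @extends_continuously_slice R n _ _ _ _ t
    (@sol_continuous_x _ _ _ _ _ _ _ sol i).
  by apply; rewrite /= in_itv.
Qed.

Lemma derive1_shift_time (f : R -> R) (h t : R) :
  derivable f (t + h) 1 ->
  is_derive t 1 (fun s => f (s + h)) (derive1 f (t + h)).
Proof.
move=> df; rewrite derive1E.
have := @is_derive1_comp R f (fun s => s + h) t _ 1 (derivableP df).
rewrite mulr1; apply.
have := @is_derive_quadratic R (fun s => s + h) h 1 0 t.
by rewrite mulr0 mul0r addr0; apply => y; ring.
Qed.

Lemma solution_regular_shift (tau h : R) :
  0 <= h -> tau + h < T -> heat_regular r tau (fun x t => u x (t + h)).
Proof.
move=> h0 hT.
have tT t : 0 < t <= tau -> 0 < t + h < T.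
  move=> /andP[t0 tt]; rewrite ltr_wpDr//=.
  by rewrite (le_lt_trans _ hT)// lerD2r.
split.
- apply/subspace_continuousP => -[x t] [/= xr]; rewrite in_itv/= => /andP[t0 tt].
  have /subspace_continuousP cu := sol_continuous sol.
  have tT' s : 0 <= s <= tau -> 0 <= s + h < T.
    move=> /andP[s0 ss]; rewrite addr_ge0//=.
    by rewrite (le_lt_trans _ hT)// lerD2r.
  have xt : (cball r `*` `[0, T[) (x, t + h).
    by split; rewrite //= in_itv/= tT'// t0.
  apply: cvg_trans (cu _ xt).
  apply: (@cvg_app _ _ ((fun z : 'rV[R]_n * R => (z.1, z.2 + h)) @
    within (cball r `*` `[0, tau]) (nbhs (x, t))) _
    (fun z : 'rV[R]_n * R => u z.1 z.2)).
  apply: cvg_to_within.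
    apply: (@cvg_within_filter _ _ _ (nbhs (x, t))).
    apply: (@cvg_pair _ _ _ (nbhs (x, t)) (nbhs x) (nbhs (t + h)) (nbhs_filter (x, t))).
      exact: cvg_fst.
    by apply: cvgD; [exact: cvg_snd|exact: cvg_cst].
  have := withinT (cball r `*` `[0, tau]) (nbhs_filter (x, t)).
  apply: filterS => -[y s] [/= yr]; rewrite in_itv/= => ss.
  by split; rewrite //= in_itv/= tT'.
- by move=> t /tT tt; apply: solution_slice_C1.
- by move=> i x t xr /tT tt; apply: (sol_derivable_xx sol).
- move=> x t xr /tT tt.
  have d := derive1_shift_time (sol_derivable_t sol xr tt).
  exact: (@ex_derive _ _ _ _ _ _ _ d).
Qed.

Lemma solution_heat_shift (x : 'rV[R]_n) (t h : R) :
  oball r x -> 0 < t + h < T ->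
  derive1 (fun s => u x (s + h)) t = laplacian (u ^~ (t + h)) x.
Proof.
move=> xr tT; rewrite -(sol_heat sol xr tT).
have d := derive1_shift_time (sol_derivable_t sol xr tT).
by rewrite derive1E (@derive_val _ _ _ _ _ _ _ d).
Qed.

Lemma solution_regular (tau : R) : tau < T -> heat_regular r tau u.
Proof.
move=> tT; have := @solution_regular_shift tau 0 (lexx 0).
rewrite addr0 => /(_ tT); congr heat_regular.
by apply/funext => x; apply/funext => t; rewrite addr0.
Qed.

(** The initial condition is imposed on the open ball and passes to the sphere by
continuity along rays. *)
Lemma solution_initial_cball (x : 'rV[R]_n) :
  0 < T -> {within cball r, continuous u0} -> cball r x -> u x 0 = u0 x.
Proof.
move=> T0 cu0 xr; have [xs|xin] := eqVneq (enorm x) r; last first.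
  by apply: (sol_initial sol); rewrite /oball/= lt_neqAle xin.
have cu : {within cball r, continuous (u ^~ 0)}.
  by apply: solution_slice_continuous; rewrite lexx.
have lu0 := cvg_along_inward_ray r0 cu0 xs.
have lu := cvg_along_inward_ray r0 cu xs.
suff lu' : u (s *: - x + x) 0 @[s --> (0:R)^'+] --> u0 x.
  exact: (cvg_unique _ lu lu').
apply: cvg_trans lu0.
apply: near_eq_cvg.
have := @cvg_inward_ray R n r x r0 xs (oball r) (withinT _ _).
move=> H; near=> s.
have sr : oball r (s *: - x + x) by near: s; exact: H.
by rewrite (sol_initial sol sr).
Unshelve. all: by end_near. Qed.

Lemma continuous_time_constant (tau : R) (v : 'rV[R]_n -> R) :
  {within cball r, continuous v} ->
  {within cball r `*` `[0, tau], continuous (fun z : 'rV[R]_n * R => v z.1)}.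
Proof.
move=> /subspace_continuousP cv; apply/subspace_continuousP => -[x t] [/= xr _].
apply: cvg_trans (cv _ xr).
apply: (@cvg_app _ _ ((fun z : 'rV[R]_n * R => z.1) @
    within (cball r `*` `[0, tau]) (nbhs (x, t))) _ v).
apply: cvg_to_within.
  apply: (@cvg_within_filter _ _ _ (nbhs (x, t))); exact: cvg_fst.
have := withinT (cball r `*` `[0, tau]) (nbhs_filter (x, t)).
by apply: filterS => -[y s] [].
Qed.

Lemma smooth_C1 : smooth_on_cball r u0 -> C1_on_cball r u0.
Proof.
move=> [cu0 du0 eu0]; split => //; first by move=> i x; exact: (du0 [::]).
by move=> i; exact: (eu0 [:: i]).
Qed.

Lemma initial_regular (tau : R) :
  smooth_on_cball r u0 -> heat_regular r tau (fun x _ => u0 x).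
Proof.
move=> su0; have [cu0 du0 eu0] := su0; split.
- exact: continuous_time_constant.
- by move=> t _; exact: smooth_C1.
- by move=> i x t xr _; exact: (du0 [:: i]).
- by move=> x t _ _; exact: derivable_cst.
Qed.

Lemma smooth_laplacian_interior (x : 'rV[R]_n) :
  smooth_on_cball r u0 -> oball r x ->
  cball_ext r (laplacian u0) x = laplacian u0 x.
Proof.
move=> [_ _ eu0] xr; apply: cball_ext_interior => //.
apply: (cvg_sumr (nbhs_filter x)) => i.
exact: (extends_continuously_at (eu0 [:: i; i]) xr).
Qed.

Lemma cylinder_bounded (tau : R) (F : 'rV[R]_n -> R -> R) :
  0 <= tau -> {within cball r `*` `[0, tau], continuous (fun z => F z.1 z.2)} ->
  exists M, forall x t, cball r x -> 0 <= t <= tau -> F x t <= M.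
Proof.
move=> tau0 cF.
have [|x [t [_ _ H]]] := @cylinder_min R n r tau r0 tau0 (fun x t => - F x t).
  by move=> z; apply: cvgN; exact: cF.
exists (F x t) => y s yr ss; rewrite -lerN2; exact: H.
Qed.

End Solution.

(** * The flux exp (s^p) *)

Lemma is_derive_expR_powR (R : realType) (p s : R) : 0 < s ->
  is_derive s 1 (fun y => expR (y `^ p)) (expR (s `^ p) * (p * s `^ (p - 1))).
Proof. by move=> s0; apply: is_derive_expRf; exact: is_derive1_powR. Qed.

Lemma expR_powR_continuous (R : realType) (p a b : R) :
  0 < p -> 0 <= a -> a < b ->
  {within `[a, b], continuous (fun s : R => expR (s `^ p))}.
Proof.
move=> p0 a0 ab; apply/continuous_within_itvP => //.
have c0 s : 0 < s -> {for s, continuous (fun y : R => expR (y `^ p))}.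
  by move=> /(is_derive_expR_powR p) /is_derive_continuous.
split.
- move=> s; rewrite in_itv/= => /andP[sa _]; apply: c0; exact: le_lt_trans sa.
- move: a0; rewrite le_eqVlt => /predU1P[<-|a0].
    rewrite powR0 ?gt_eqF//; apply: continuous_cvg; first exact: continuous_expR.
    exact: powR_cvg0.
  exact/cvg_at_right_filter/c0.
- by apply/cvg_at_left_filter/c0; exact: le_lt_trans ab.
Qed.

Lemma expR_powR_lipschitz (R : realType) (p M : R) : 1 < p -> 0 <= M ->
  exists2 L, 0 <= L & forall a b, 0 <= a -> a <= b -> b <= M ->
    expR (b `^ p) - expR (a `^ p) <= L * (b - a).
Proof.
move=> p1 M0; have p0 : 0 < p by exact: lt_trans p1.
exists (expR (M `^ p) * (p * M `^ (p - 1))).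
  by rewrite mulr_ge0 ?expR_ge0// mulr_ge0 ?powR_ge0// ltW.
move=> a b a0; rewrite le_eqVlt => /predU1P[->|ab] bM.
  by rewrite !subrr mulr0.
have dab (s : R) : s \in `]a, b[ ->
    is_derive s 1 (fun y => expR (y `^ p)) (expR (s `^ p) * (p * s `^ (p - 1))).
  rewrite in_itv/= => /andP[sa _]; apply: is_derive_expR_powR.
  exact: le_lt_trans sa.
have [c] := MVT ab dab (expR_powR_continuous p0 a0 ab).
rewrite in_itv/= => /andP[ac cb] ->.
have c0 : 0 <= c by rewrite (le_trans a0)// ltW.
have cM : c <= M by rewrite (le_trans _ bM)// ltW.
rewrite ler_wpM2r ?subr_ge0 ?(ltW ab)//.
rewrite ler_pM ?expR_ge0//.
- by rewrite mulr_ge0 ?powR_ge0// ltW.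
- by rewrite ler_expR ge0_ler_powR// ?nnegrE// ltW.
- by rewrite ler_pM2l// ge0_ler_powR// ?nnegrE// subr_ge0 ltW.
Qed.

(** Beyond 2^(1/(p-1)) the derivative p s^(p-1) exceeds 2 p. *)
Lemma powR_sub_linear_lt (R : realType) (p a b : R) : 1 < p ->
  2 `^ (p - 1)^-1 <= a -> a < b -> a `^ p - 2 * p * a < b `^ p - 2 * p * b.
Proof.
move=> p1 Sa ab.
have p0 : 0 < p by exact: lt_trans p1.
have q0 : 0 < p - 1 by rewrite subr_gt0.
have S0 : 0 < 2 `^ (p - 1)^-1 :> R by rewrite powR_gt0.
have a0 : 0 < a by exact: lt_le_trans Sa.
have dab (s : R) : s \in `]a, b[ -> is_derive s 1 (fun y => y `^ p) (p * s `^ (p - 1)).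
  rewrite in_itv/= => /andP[sa _]; apply: is_derive1_powR.
  exact: lt_trans sa.
have cab : {within `[a, b], continuous (fun s : R => s `^ p)}.
  apply: derivable_within_continuous => s; rewrite in_itv/= => /andP[sa _].
  have s0 : 0 < s by exact: lt_le_trans sa.
  exact: (@ex_derive _ _ _ _ _ _ _ (is_derive1_powR p s0)).
have [c] := MVT ab dab cab.
rewrite in_itv/= => /andP[ac cb] E.
have c2 : 2 < c `^ (p - 1).
  have -> : 2 = (2 `^ (p - 1)^-1) `^ (p - 1) :> R.
    by rewrite -powRrM mulVf ?gt_eqF// powRr1.
  rewrite gt0_ltr_powR// ?nnegrE ?(ltW S0)//.
    by rewrite ltW// (lt_trans a0).
  exact: le_lt_trans ac.
have : 2 * p * (b - a) < p * c `^ (p - 1) * (b - a).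
  by rewrite ltr_pM2r ?subr_gt0// [2 * p]mulrC ltr_pM2l.
rewrite -E; lra.
Qed.

(** From 1 - e^(-z) >= z / (1 + z) with z = k a h; bounding the denominator by its
value at h = T makes the constant independent of h. *)
Lemma expR_gap (R : realType) (k a T M w y h : R) :
  0 < k -> 0 < a -> 0 < h -> h <= T -> w <= M -> w + a * h <= y ->
  expR (- k * M) * (k * a) / (1 + k * a * T) * h <=
  expR (- k * w) - expR (- k * y).
Proof.
move=> k0 a0 h0 hT wM wy.
have kah0 : 0 < k * a * h by rewrite !mulr_gt0.
have kahT : k * a * h <= k * a * T by rewrite ler_pM2l// mulr_gt0.
have den : 0 < 1 + k * a * h by rewrite addr_gt0.
have denT : 0 < 1 + k * a * T by lra.
have gap : k * a * h / (1 + k * a * h) <= 1 - expR (- (k * a * h)).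
  have e0 := expR_gt0 (k * a * h).
  have : 1 + k * a * h <= expR (k * a * h) by exact: expR_ge1Dx.
  rewrite -(lef_pV2 (x := expR _)) ?posrE// -expRN.
  have -> : k * a * h / (1 + k * a * h) = 1 - (1 + k * a * h)^-1.
    by field; rewrite gt_eqF.
  lra.
apply: (@le_trans _ _ (expR (- k * w) * (1 - expR (- (k * a * h))))); last first.
  rewrite mulrBr mulr1 -expRD lerD2l lerN2 ler_expR.
  have : k * (w + a * h) <= k * y by rewrite ler_pM2l.
  lra.
have -> : expR (- k * M) * (k * a) / (1 + k * a * T) * h =
  expR (- k * M) * (k * a * h / (1 + k * a * T)) by field; rewrite gt_eqF.
apply: ler_pM; rewrite ?expR_ge0//.
- by rewrite divr_ge0// ltW.
- by rewrite ler_expR !mulNr lerN2 ler_pM2l.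
- apply: le_trans gap; rewrite ler_pM2l// lef_pV2 ?posrE//; lra.
Qed.

(** * Growth in time and the blow-up rate *)

Lemma lipschitz_flux_lower (R : realType) (L x y fx fy fz : R) :
  fy - fx <= L * (y - x) -> fz <= fy -> L * (x - y) <= fx - fz.
Proof. by lra. Qed.

Lemma le_heat_operators (R : realType) (ft lf gt lg : R) :
  ft = lf -> gt = lg -> ft + 0 - lf <= gt - lg.
Proof. by move=> -> ->; rewrite addr0 !subrr. Qed.

Section Blowup.
Context {R : realType} {n : nat}.
Variables (r p T a : R) (u0 : 'rV[R]_n -> R) (u : 'rV[R]_n -> R -> R).
Hypotheses (r0 : 0 < r) (p1 : 1 < p) (T0 : 0 < T) (a0 : 0 < a)
  (su0 : smooth_on_cball r u0)
  (u0_ge0 : forall x, cball r x -> 0 <= u0 x)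
  (u0_flux : forall x, esphere r x ->
     normal_derivative r u0 x = expR (u0 x `^ p))
  (u0_laplacian : forall x, cball r x -> a <= cball_ext r (laplacian u0) x)
  (sol : classical_solution r p T u0 u).

(** [u0 x + a t] is a subsolution: its Laplacian is at least [a], and its flux
exp (u0^p) is at most exp ((u0 + a t)^p). *)
Lemma solution_ge_initial (x : 'rV[R]_n) (t : R) :
  cball r x -> 0 <= t < T -> u0 x + a * t <= u x t.
Proof.
move=> xr tT; have [t0 tT'] := andP tT.
have tt : 0 <= t <= t by rewrite t0 lexx.
have regu : heat_regular r t u by apply: (solution_regular sol).
have regu0 : heat_regular r t (fun x _ => u0 x) by exact: initial_regular.
have [M HM] : exists M, forall x s, cball r x -> 0 <= s <= t -> u0 x + a * t <= M.
  have [M HM] := cylinder_bounded r0 t0 (hr_continuous regu0).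
  by exists (M + a * t) => y s yr ss; rewrite lerD2r; exact: HM ss.
have M0 : 0 <= M.
  apply: le_trans (HM x 0 xr _); last by rewrite lexx.
  by rewrite addr_ge0 ?u0_ge0// mulr_ge0 ?(ltW a0).
have [L L0 HL] := expR_powR_lipschitz p1 M0.
have := @comparison R n r t L a 0 u (fun x _ => u0 x) r0 t0 regu regu0 _ _ _ x t xr tt.
rewrite addr0; apply.
- move=> y yr; rewrite addr0 (solution_initial_cball r0 sol T0) ?lexx//.
  by case: su0.
- move=> y s yr /andP[s0 st].
  have sT : 0 < s < T by rewrite s0 (le_lt_trans st).
  rewrite derive1_cst add0r (sol_heat sol yr sT) subrr subr_le0.
  rewrite -(smooth_laplacian_interior su0 yr); apply: u0_laplacian.
  exact: oball_sub_cball.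
- move=> y s ys /andP[s0 st]; rewrite addr0 => us.
  have yr := esphere_sub_cball ys.
  have sT : 0 < s < T by rewrite s0 (le_lt_trans st).
  rewrite (sol_flux sol ys sT) (u0_flux ys).
  have uge0 : 0 <= u y s by apply: (sol_ge0 sol) => //; case/andP: sT => /ltW -> ->.
  have as0 : 0 <= a * s by rewrite mulr_ge0 ?ltW.
  have le_as : u0 y + a * s <= M.
    apply: le_trans (HM y 0 yr _); last by rewrite lexx.
    by rewrite lerD2l ler_pM2l.
  have Lip := HL _ _ uge0 (ltW us) le_as.
  have mono : expR (u0 y `^ p) <= expR ((u0 y + a * s) `^ p).
    by rewrite ler_expR ge0_ler_powR// ?nnegrE ?addr_ge0 ?u0_ge0// ?lerDl//
      ltW// (lt_trans _ p1).
  exact: (lipschitz_flux_lower Lip mono).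
Qed.

(** [u x t + a h] is a subsolution for the flux condition, as the flux is increasing,
and lies below [u x (t + h)] at time 0. *)
Lemma solution_increases (x : 'rV[R]_n) (t h : R) :
  cball r x -> 0 <= t -> 0 < h -> t + h < T -> u x t + a * h <= u x (t + h).
Proof.
move=> xr t0 h0 thT.
have tT : t < T by rewrite (le_lt_trans _ thT)// lerDl ltW.
have tt : 0 <= t <= t by rewrite t0 lexx.
have regu : heat_regular r t u by apply: (solution_regular sol).
have reguh := solution_regular_shift sol (ltW h0) thT.
have ah0 : 0 <= a * h by rewrite mulr_ge0 ?ltW.
have [M HM] := cylinder_bounded r0 t0 (hr_continuous regu).
have M0 : 0 <= M + a * h.
  rewrite addr_ge0//; apply: le_trans (HM x t xr _); last by rewrite t0 lexx.
  by apply: (sol_ge0 sol) => //; rewrite t0.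
have [L L0 HL] := expR_powR_lipschitz p1 M0.
have := @comparison R n r t L 0 (a * h) (fun x t => u x (t + h)) u
  r0 t0 reguh regu _ _ _ x t xr tt.
rewrite mul0r (add0r (a * h)); apply.
- move=> y yr; rewrite (solution_initial_cball r0 sol T0)//; last by case: su0.
  rewrite add0r; apply: solution_ge_initial => //.
  by rewrite ltW//= (le_lt_trans _ thT)// lerDr.
- move=> y s yr /andP[s0 st].
  have sT : 0 < s < T by rewrite s0 (le_lt_trans st).
  have shT : 0 < s + h < T.
    by rewrite addr_gt0//= (le_lt_trans _ thT)// lerD2r.
  exact: (le_heat_operators (sol_heat sol yr sT) (solution_heat_shift sol yr shT)).
- move=> y s ys /andP[s0 st]; rewrite mul0r add0r => us.
  have yr := esphere_sub_cball ys.
  have sT : 0 < s < T by rewrite s0 (le_lt_trans st).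
  have shT : 0 < s + h < T.
    by rewrite addr_gt0//= (le_lt_trans _ thT)// lerD2r.
  rewrite (sol_flux sol ys sT) (sol_flux sol ys shT).
  have uge0 : 0 <= u y s by apply: (sol_ge0 sol) => //; case/andP: sT => /ltW -> ->.
  have uhge0 : 0 <= u y (s + h).
    by apply: (sol_ge0 sol) => //; case/andP: shT => /ltW -> ->.
  have le_M : u y s + a * h <= M + a * h.
    by rewrite lerD2r HM// st ltW.
  have Lip := HL _ _ uhge0 (ltW us) le_M.
  have mono : expR (u y s `^ p) <= expR ((u y s + a * h) `^ p).
    by rewrite ler_expR ge0_ler_powR// ?nnegrE ?addr_ge0// ?lerDl//
      ltW// (lt_trans _ p1).
  exact: (lipschitz_flux_lower Lip mono).
Qed.

(** The bound is direct where [u <= M1], since [u] has grown by [a h]; this covers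
time 0 and the points of the sphere with [u <= S].  At the other points of the
sphere the flux inequality is the monotonicity of s^p - 2 p s. *)
Lemma solution_exp_decrease : exists2 e : R, 0 < e &
  forall (x : 'rV[R]_n) (t h : R), cball r x -> 0 <= t -> 0 < h -> t + h < T ->
    e * h <= expR (- (2 * p) * u x t) - expR (- (2 * p) * u x (t + h)).
Proof.
have p0 : 0 < p by exact: lt_trans p1.
have k0 : 0 < 2 * p by rewrite mulr_gt0.
have regu0 : heat_regular r 0 u by apply: (solution_regular sol).
have [M HM] := cylinder_bounded r0 (lexx 0) (hr_continuous regu0).
pose S := 2 `^ (p - 1)^-1 : R.
pose M1 := Num.max S M.
have kaT : 0 < 1 + 2 * p * a * T by rewrite addr_gt0// !mulr_gt0.
exists (expR (- (2 * p) * M1) * (2 * p * a) / (1 + 2 * p * a * T)).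
  by rewrite divr_gt0// mulr_gt0 ?expR_gt0// mulr_gt0.
move=> x t h xr t0 h0 thT.
have tT : t < T by rewrite (le_lt_trans _ thT)// lerDl ltW.
have hT : h <= T by rewrite ltW// (le_lt_trans _ thT)// lerDr.
have ah0 : 0 < a * h by rewrite mulr_gt0.
have tt : 0 <= t <= t by rewrite t0 lexx.
have regu : heat_regular r t u by apply: (solution_regular sol).
have reguh := solution_regular_shift sol (ltW h0) thT.
have inc y s : cball r y -> 0 <= s <= t -> u y s + a * h <= u y (s + h).
  move=> yr /andP[s0 st]; apply: solution_increases => //.
  by rewrite (le_lt_trans _ thT)// lerD2r.
apply: (@exp_comparison R n r t (2 * p) _ (fun x t => u x (t + h)) u) => //.
- by move=> y s yr ss; rewrite (lt_le_trans _ (inc _ _ yr ss))// ltrDl.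
- move=> y s yr /andP[s0 st]; apply: (solution_heat_shift sol yr).
  by rewrite addr_gt0//= (le_lt_trans _ thT)// lerD2r.
- move=> y s yr /andP[s0 st]; apply: (sol_heat sol yr).
  by rewrite s0 (le_lt_trans st).
- move=> y yr; apply: expR_gap => //.
    by rewrite le_max HM ?orbT// lexx.
  by apply: inc => //; rewrite lexx.
- move=> y s ys /andP[s0 st].
  have yr := esphere_sub_cball ys.
  have ss : 0 <= s <= t by rewrite ltW.
  have sT : 0 < s < T by rewrite s0 (le_lt_trans st).
  have shT : 0 < s + h < T.
    by rewrite addr_gt0//= (le_lt_trans _ thT)// lerD2r.
  have [uS|Su] := leP (u y s) S.
    left; apply: expR_gap => //; first by rewrite le_max uS.
    exact: inc.
  right; rewrite (sol_flux sol ys sT) (sol_flux sol ys shT) -!expRD ltr_expR !mulNr.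
  apply: powR_sub_linear_lt => //; first exact: ltW.
  by rewrite (lt_le_trans _ (inc _ _ yr ss))// ltrDl.
Qed.

Lemma blowup_rate : exists2 C : R, 0 < C &
  forall (x : 'rV[R]_n) (t : R), cball r x -> 0 < t < T ->
    u x t <= ln C - (2 * p)^-1 * ln (T - t).
Proof.
have [e e0 He] := solution_exp_decrease.
have p0 : 0 < p by exact: lt_trans p1.
have k0 : 0 < 2 * p by rewrite mulr_gt0.
exists (expR (- ((2 * p)^-1 * ln e))); first exact: expR_gt0.
move=> x t xr /andP[t0 tT].
have Tt : 0 < T - t by rewrite subr_gt0.
have bound : e * (T - t) <= expR (- (2 * p) * u x t).
  rewrite -ler_pdivlMl// leNgt; apply/negP => lt_e.
  set y := e^-1 * _ in lt_e.
  have y0 : 0 < y by rewrite mulr_gt0 ?invr_gt0 ?expR_gt0.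
  (* A time step strictly between the supposed bound [y] and [T - t]. *)
  have := @He x t ((y + (T - t)) / 2) xr (ltW t0).
  have h0 : 0 < (y + (T - t)) / 2 by lra.
  have hT : t + (y + (T - t)) / 2 < T by lra.
  move=> /(_ h0 hT); apply/negP; rewrite -ltNge.
  have := expR_gt0 (- (2 * p) * u x (t + (y + (T - t)) / 2)).
  have -> : expR (- (2 * p) * u x t) = e * y by rewrite /y mulVKf// gt_eqF.
  have : e * y < e * ((y + (T - t)) / 2) by rewrite ltr_pM2l//; lra.
  lra.
have : ln (e * (T - t)) <= - (2 * p) * u x t.
  rewrite -[leRHS]expRK; by rewrite ler_ln ?posrE ?expR_gt0 ?mulr_gt0.
rewrite lnM ?posrE// expRK -(ler_pM2l (x := (2 * p)^-1)) ?invr_gt0//.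
rewrite mulNr mulrN mulKf ?gt_eqF//; lra.
Qed.

End Blowup.

Unset Implicit Arguments.

Theorem theorem3p2 (R : realType) (n : nat) (r p T : R)
    (u0 : 'rV[R]_n -> R) (u : 'rV[R]_n -> R -> R)
    (hn : (1 <= n)%N) (hr : 0 < r) (hp : 1 < p)
    (u0_smooth : smooth_on_cball r u0)
    (u0_neq0 : exists2 x, cball r x & u0 x != 0)
    (u0_ge0 : forall x, cball r x -> 0 <= u0 x)
    (u0_radial : radial_on_cball r u0)
    (u0_flux : forall x, esphere r x ->
       normal_derivative r u0 x = expR (u0 x `^ p))
    (u0_laplacian : exists2 a : R, 0 < a &
       forall x, cball r x -> a <= cball_ext r (laplacian u0) x)
    (u_blowup : blows_up_at r p T u0 u) :
  exists2 C : R, 0 < C &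
    forall t : R, 0 < t < T ->
      max_cball r (u ^~ t) <= ln C - (2 * p)^-1 * ln (T - t).
Proof.
have [a a0 lap] := u0_laplacian; have [T0 sol _] := u_blowup.
have [C C0 HC] := blowup_rate hr hp T0 a0 u0_smooth u0_ge0 u0_flux lap sol.
exists C => // t tT; apply: ge_sup; last by move=> _ [x xr <-]; exact: HC.
by exists (u 0 t), 0 => //; rewrite /cball/= enorm0 ltW.
Qed.
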